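(* Let $1\le s\le n$ and let $A=(a_{i,j})$ be an $s\times n$ matrix with entries in a totally ordered commutative group $M$. Jacobi's algorithm (described in the context) applied to $A$ terminates and returns the minimal canon $\lambda$ of $A$, in at most $O(s^3n)$ elementary operations. If moreover the entries are non-negative integers with $a_{i,j}\le C$ (where $C\ge 2$), it requires at most $O(s^3n\log C)$ bit operations.
   Context: Elementary operations are additions, subtractions and comparisons in $M$ together with constant-cost access to matrix entries and bookkeeping. A maximum (maximal element) of a matrix is an entry maximal in its column; transversal maxima are maxima located in pairwise different rows and columns. For $\ell=(\ell_1,\dots,\ell_s)$, $A+\ell$ is the matrix $(a_{i,j}+\ell_i)$. A canon of $A$ is a vector $\ell\in M^s$ with all $\ell_i\ge0$ such that $A+\ell$ possesses $s$ transversal maxima. Canons are partially ordered by $\ell\le\ell'$ iff $\ell_i\le\ell_i'$ for all $i$; the minimal canon is the (unique) least one. Jacobi's algorithm. If $s=1$ return $\ell=0$. Otherwise: (1) Increase each row $i$ by the least amount making one of its elements maximal: $\ell_i=\min_{j}\max_{i'}(a_{i',j}-a_{i,j})$. Find a set $T$ of 2 transversal maxima (it exists). (2) While $|T|<s$: call the elements of $T$ starred; upper rows and left columns are those containing an element of $T$, the others are lower rows and right columns. (b) If there is a maximum in a lower row and a right column, add it to $T$. (c) Otherwise, there is an elementary path from row $i$ to row $i'$ if the starred element of the upper row $i$ equals the element of row $i'$ in the same column; paths are obtained by transitivity. First class rows are the upper rows containing a right maximum and all rows to which there is a path from such a row. (d) If some lower row is of the first class, take a path $i_0,\dots,i_p$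 from an upper row $i_0$ containing a right maximum to that lower row $i_p$; replace in $T$ the starred elements of rows $i_0,\dots,i_{p-1}$ by the elements of rows $i_1,\dots,i_p$, respectively, located in the same columns, and add the right maximum of row $i_0$. (e) Otherwise, the third class consists of the lower rows and all rows from which there is a path to a lower row; the second class consists of the remaining rows not in the first class. Increase all third class rows by the smallest value such that one of their elements becomes equal to a right maximum or to a starred element located in a first or second class row in the same column. When $|T|=s$, return the vector $\ell$ of total increments of the rows. $F=O(G)$ means $F\le aG+b$ for some constants $a,b$. *)

(* Defs.v *)
From HB Require Import structures.
From mathcomp Require Import all_boot all_order all_algebra.
Set Implicit Arguments.
Unset Strict Implicit.
Unset Printing Implicit Defensive.
Import Order.TTheory GRing.Theory Num.Theory.
Local Open Scope ring_scope.

(* Matrices have entries in a [porderZmodType], which is an additive group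
   carrying an unrelated partial order: totality of the order and its
   invariance under translation are hypotheses of the theorem. *)

Section Canons.
Variables (M : porderZmodType) (s n : nat).
Implicit Types (A B : 'M[M]_(s, n)) (l : {ffun 'I_s -> M}).
Implicit Types (T : {set 'I_s * 'I_n}).

Definition shift A l : 'M[M]_(s, n) := \matrix_(i, j) (A i j + l i).

Definition is_max B i j : bool := [forall k, B k j <= B i j].

Definition transversal_maxima B T : Prop :=
  [/\ {in T &, injective (@fst 'I_s 'I_n)},
      {in T &, injective (@snd 'I_s 'I_n)}
    & {in T, forall p, is_max B p.1 p.2}].

Definition canon A l : Prop :=
  (forall i, 0 <= l i) /\
  exists2 T, transversal_maxima (shift A l) T & #|T| = s.

Definition minimal_canon A l : Prop :=
  canon A l /\ forall l', canon A l' -> forall i, l i <= l' i.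

End Canons.

Section Algorithm.
Variables (M : porderZmodType) (s n : nat).
Implicit Types (A B : 'M[M]_(s, n)) (l : {ffun 'I_s -> M}).
Implicit Types (T : {set 'I_s * 'I_n}) (i k : 'I_s) (j : 'I_n).

Definition least (P : M -> Prop) x : Prop := P x /\ forall y, P y -> x <= y.
Definition greatest (P : M -> Prop) x : Prop := P x /\ forall y, P y -> y <= x.

Definition upper_row T i : bool := [exists j, (i, j) \in T].
Definition left_col T j : bool := [exists i, (i, j) \in T].

Definition right_max B T i j : bool := ~~ left_col T j && is_max B i j.

Definition elem_path B T : rel 'I_s :=
  fun i k => [exists j, ((i, j) \in T) && (B k j == B i j)].

Definition class1 B T i : bool :=
  [exists k, [&& upper_row T k, [exists j, right_max B T k j]
               & connect (elem_path B T) k i]].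
Definition class3 B T i : bool :=
  [exists k, ~~ upper_row T k && connect (elem_path B T) i k].
Definition class2 B T i : bool := ~~ class1 B T i && ~~ class3 B T i.

(* The path is [i0 :: p].  The stars of all its rows but the last are removed;
   each row of [p] is starred in the column where its predecessor was. *)
Definition switch T i0 (p : seq 'I_s) j0 : {set 'I_s * 'I_n} :=
  (i0, j0) |: ([set q in T | q.1 \notin belast i0 p] :|:
    [set q | [exists i, ((i, q.1) \in zip (belast i0 p) p)
                        && ((i, q.2) \in T)]]).

Definition raise_candidate B T (d : M) : Prop :=
  exists i j k, [/\ class3 B T i,
    right_max B T k j || [&& (k, j) \in T & class1 B T k || class2 B T k]
    & B i j + d = B k j].

Inductive config : Type :=
| Start
| Loop of {ffun 'I_s -> M} & {set 'I_s * 'I_n}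
| Done of {ffun 'I_s -> M}.

(* One transition of the algorithm.  The relation is not functional: the choice
   of the initial pair of maxima, of the maximum added to [T], and of the path
   and right maximum used to augment [T] are all left free. *)
Inductive jacobi_step A : config -> config -> Prop :=
| step_trivial : s = 1%N ->
    jacobi_step A Start (Done [ffun=> 0])
| step_init l T :
    (1 < s)%N ->
    (forall i, least (fun x => exists j,
       greatest (fun y => exists k, y = A k j - A i j) x) (l i)) ->
    transversal_maxima (shift A l) T -> #|T| = 2 ->
    jacobi_step A Start (Loop l T)
| step_add l T i j :
    (#|T| < s)%N ->
    ~~ upper_row T i -> right_max (shift A l) T i j ->
    jacobi_step A (Loop l T) (Loop l ((i, j) |: T))
| step_switch l T i0 p j0 (B := shift A l) :
    (#|T| < s)%N ->
    (forall i j, ~~ upper_row T i -> ~~ right_max B T i j) ->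
    upper_row T i0 -> right_max B T i0 j0 ->
    path (elem_path B T) i0 p -> uniq (i0 :: p) ->
    ~~ upper_row T (last i0 p) ->
    jacobi_step A (Loop l T) (Loop l (switch T i0 p j0))
| step_raise l T d (B := shift A l) :
    (#|T| < s)%N ->
    (forall i j, ~~ upper_row T i -> ~~ right_max B T i j) ->
    (forall i, ~~ upper_row T i -> ~~ class1 B T i) ->
    least (raise_candidate B T) d ->
    jacobi_step A (Loop l T)
                  (Loop [ffun i => if class3 B T i then l i + d else l i] T)
| step_return l T :
    #|T| = s ->
    jacobi_step A (Loop l T) (Done l).

(* [jacobi_run A c cs]: the algorithm can pass successively through the
   configurations of [c :: cs]. *)
Fixpoint jacobi_run A (c : config) (cs : seq config) : Prop :=
  if cs is c' :: cs' then jacobi_step A c c' /\ jacobi_run A c' cs' else True.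

Definition terminates A : Prop :=
  Acc (fun c' c => jacobi_step A c c') Start.

(* Every maximal run ends by returning [l]. *)
Definition always_returns A l : Prop :=
  forall cs, jacobi_run A Start cs ->
    (forall c, ~ jacobi_step A (last Start cs) c) -> last Start cs = Done l.

End Algorithm.
Arguments Start {M s n}.
Arguments Loop {M s n} _ _.
Arguments Done {M s n} _.

(* An implementation of the algorithm on a random access machine.  A computation
   returns a value together with the trace of all operations it performed.
   Arithmetic and comparisons on [M] are only available through [add], [sub],
   [leM] and [eqM]; arrays are finite functions, read and written one cell at a
   time; each iteration of a loop leaves at least one operation in the trace.
   Between two traced operations only a bounded number of tests on booleans,
   options, indices and list heads takes place. *)

Section Machine.
Variable M : porderZmodType.

Inductive op : Type :=
| Add of M & M
| Sub of M & M
| Cmp of M & M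
| Move of M   (* reading or writing of an element of M in an array *)
| Book.       (* any other elementary bookkeeping *)

Definition comp (X : Type) : Type := (seq op * X)%type.

Definition ret X (x : X) : comp X := ([::], x).
Definition bind X Y (m : comp X) (f : X -> comp Y) : comp Y :=
  let r := f m.2 in (m.1 ++ r.1, r.2).

Definition tick : comp unit := ([:: Book], tt).
Definition add (x y : M) : comp M := ([:: Add x y], x + y).
Definition sub (x y : M) : comp M := ([:: Sub x y], x - y).
Definition leM (x y : M) : comp bool := ([:: Cmp x y], x <= y).
Definition eqM (x y : M) : comp bool := ([:: Cmp x y], x == y).

Definition alloc (I : finType) X (x : X) : comp {ffun I -> X} :=
  (nseq #|I| Book, [ffun=> x]).
Definition upd (I : finType) X (f : {ffun I -> X}) (i : I) (x : X) :
  {ffun I -> X} := [ffun k => if k == i then x else f k].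
Definition read (I : finType) X (f : {ffun I -> X}) (i : I) : comp X :=
  ([:: Book], f i).
Definition write (I : finType) X (f : {ffun I -> X}) (i : I) (x : X) :
  comp {ffun I -> X} := ([:: Book], upd f i x).
Definition readM (I : finType) (f : {ffun I -> M}) (i : I) : comp M :=
  ([:: Move (f i)], f i).
Definition writeM (I : finType) (f : {ffun I -> M}) (i : I) (x : M) :
  comp {ffun I -> M} := ([:: Move x], upd f i x).
Definition entry s n (A : 'M[M]_(s, n)) i j : comp M :=
  ([:: Move (A i j)], A i j).

Fixpoint foreach I X (r : seq I) (x : X) (body : I -> X -> comp X) : comp X :=
  if r is i :: r' then
    bind tick (fun=> bind (body i x) (fun y => foreach r' y body))
  else bind tick (fun=> ret x).

Fixpoint first_some I Y (r : seq I) (f : I -> comp (option Y)) :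
    comp (option Y) :=
  if r is i :: r' then
    bind tick (fun=> bind (f i) (fun o =>
      if o is Some y then ret (Some y) else first_some r' f))
  else bind tick (fun=> ret None).

End Machine.
Arguments Book {M}.
Arguments ret {M X} _.
Arguments tick {M}.
Arguments alloc {M} I {X} _.
Arguments read {M I X} _ _.
Arguments write {M I X} _ _ _.
Arguments foreach {M I X} _ _ _.
Arguments first_some {M I Y} _ _.

Declare Scope comp_scope.
Delimit Scope comp_scope with comp.
Notation "'let!' x ':=' m 'in' k" := (bind m (fun x => k))
  (at level 200, x pattern, m at level 200, k at level 200,
   format "'[v' 'let!'  x  ':='  m  'in' '/' k ']'") : comp_scope.
Local Open Scope comp_scope.

Section Program.
Variables (M : porderZmodType) (s n : nat) (A : 'M[M]_(s, n)).
Implicit Types (l : {ffun 'I_s -> M}) (mx : {ffun 'I_n -> M}).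
Implicit Types (i k : 'I_s) (j : 'I_n).

Let rows := enum 'I_s.
Let cols := enum 'I_n.

Definition shifted l i j : comp M M :=
  let! x := entry A i j in
  let! y := readM l i in
  add x y.

Definition col_max l j : comp M M :=
  let! m := foreach rows None (fun i acc =>
    let! x := shifted l i j in
    if acc is Some y then
      let! b := leM x y in ret (Some (if b then y else x))
    else ret (Some x)) in
  ret (odflt 0 m).

Definition col_maxima l : comp M {ffun 'I_n -> M} :=
  let! mx := alloc 'I_n 0 in
  foreach cols mx (fun j mx =>
    let! m := col_max l j in
    writeM mx j m).

Definition test_max l mx i j : comp M bool :=
  let! x := shifted l i j in
  let! m := readM mx j in
  eqM x m.

(* [rstar i] and [cstar j] give the column, resp. the row, of the starred
   element of row [i], resp. column [j]; [nstar] is the number of stars. *)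
Record pstate := PState {
  incr  : {ffun 'I_s -> M};
  rstar : {ffun 'I_s -> option 'I_n};
  cstar : {ffun 'I_n -> option 'I_s};
  nstar : nat }.

Definition pconfig (st : pstate) : config M s n :=
  Loop (incr st) [set p | rstar st p.1 == Some p.2].

Definition place_star (st : pstate) i j : comp M pstate :=
  let! r := write (rstar st) i (Some j) in
  let! c := write (cstar st) j (Some i) in
  ret (PState (incr st) r c (nstar st)).

Definition bump_nstar (st : pstate) : comp M pstate :=
  let! _ := tick in
  ret (PState (incr st) (rstar st) (cstar st) (nstar st).+1).

Definition init_increments : comp M {ffun 'I_s -> M} :=
  let! l0 := alloc 'I_s 0 in
  let! mx := col_maxima l0 in
  foreach rows l0 (fun i l =>
    let! m := foreach cols None (fun j acc =>
      let! x := readM mx j in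
      let! a := entry A i j in
      let! d := sub x a in
      if acc is Some y then
        let! b := leM d y in ret (Some (if b then d else y))
      else ret (Some d)) in
    writeM l i (odflt 0 m)).

Definition max_in_row l mx i : comp M (option 'I_n) :=
  first_some cols (fun j =>
    let! b := test_max l mx i j in ret (if b then Some j else None)).

(* Row [i1] has a maximum in column [j1].  If some other row has its first
   maximum in another column, this gives the second maximum.  Otherwise all
   rows have a maximum in column [j1]: take a maximum of another column, and
   the maximum of column [j1] in a different row. *)
Definition two_maxima l mx : comp M (option (('I_s * 'I_n) * ('I_s * 'I_n))) :=
  if rows is i1 :: rs then
    let! o1 := max_in_row l mx i1 in
    if o1 is Some j1 then
      let! o := first_some rs (fun i =>
        let! oj := max_in_row l mx i in
        if oj is Some j then
          ret (if j == j1 then None else Some ((i1, j1), (i, j)))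
        else ret None) in
      if o is Some q then ret (Some q) else
      let! oj := first_some cols (fun j =>
        ret (if j == j1 then None else Some j)) in
      if oj is Some j then
        let! oi := first_some rows (fun i =>
          let! b := test_max l mx i j in ret (if b then Some i else None)) in
        if oi is Some i then
          let! ok := first_some rows (fun k =>
            ret (if k == i then None else Some k)) in
          ret (if ok is Some k then Some ((i, j), (k, j1)) else None)
        else ret None
      else ret None
    else ret None
  else ret None.

Definition init : comp M pstate :=
  let! l := init_increments in
  let! mx := col_maxima l in
  let! r := alloc 'I_s None in
  let! c := alloc 'I_n None in
  let! o := two_maxima l mx in
  if o is Some (p, q) then
    let! st := place_star (PState l r c 0) p.1 p.2 in
    let! st := bump_nstar st in
    let! st := place_star st q.1 q.2 in
    bump_nstar st
  else ret (PState l r c 0).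

Definition row_right_max (st : pstate) mx i : comp M (option 'I_n) :=
  first_some cols (fun j =>
    let! c := read (cstar st) j in
    if c is Some _ then ret None else
    let! b := test_max (incr st) mx i j in
    ret (if b then Some j else None)).

Definition lower_right_max (st : pstate) mx : comp M (option ('I_s * 'I_n)) :=
  first_some rows (fun i =>
    let! r := read (rstar st) i in
    if r is Some _ then ret None else
    let! o := row_right_max st mx i in
    ret (if o is Some j then Some (i, j) else None)).

Definition right_maxima (st : pstate) mx : comp M {ffun 'I_s -> option 'I_n} :=
  let! rm := alloc 'I_s None in
  foreach rows rm (fun i rm =>
    let! o := row_right_max st mx i in
    write rm i o).

Definition test_edge (st : pstate) i k : comp M bool :=
  let! r := read (rstar st) i in
  if r is Some j then
    let! x := shifted (incr st) i j in
    let! y := shifted (incr st) k j in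
    eqM y x
  else ret false.

(* Graph search.  The result tells which rows can be reached from a root, and
   gives the predecessor of each of them that is not a root.  Every row enters
   the stack at most once, so that [s] rounds are enough to empty it. *)
Definition search (root : 'I_s -> comp M bool) (edge : 'I_s -> 'I_s -> comp M bool) :
    comp M ({ffun 'I_s -> bool} * {ffun 'I_s -> option 'I_s}) :=
  let! seen := alloc 'I_s false in
  let! pred := alloc 'I_s None in
  let! (seen, stack) := foreach rows (seen, [::]) (fun k '(seen, stack) =>
    let! b := root k in
    if b then
      let! seen := write seen k true in
      let! _ := tick in
      ret (seen, k :: stack)
    else ret (seen, stack)) in
  let! (seen, pred, _) := foreach rows (seen, pred, stack)
    (fun _ '(seen, pred, stack) =>
      if stack is i :: stack' then
        let! _ := tick in
        foreach rows (seen, pred, stack') (fun k '(seen, pred, stack) =>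
          let! b := read seen k in
          if b then ret (seen, pred, stack) else
          let! e := edge i k in
          if e then
            let! seen := write seen k true in
            let! pred := write pred k (Some i) in
            let! _ := tick in
            ret (seen, pred, k :: stack)
          else ret (seen, pred, stack))
      else ret (seen, pred, stack)) in
  ret (seen, pred).

Definition search_class1 (st : pstate) (rm : {ffun 'I_s -> option 'I_n}) :=
  search (fun i => let! o := read rm i in ret (isSome o)) (test_edge st).

Definition search_class3 (st : pstate) : comp M {ffun 'I_s -> bool} :=
  let! (seen, _) :=
    search (fun i => let! r := read (rstar st) i in ret (~~ isSome r))
           (fun i k => test_edge st k i) in
  ret seen.

(* The path is followed backwards, from the lower row [k] to a root. *)
Definition augment (st : pstate) (rm : {ffun 'I_s -> option 'I_n})
    (pred : {ffun 'I_s -> option 'I_s}) k : comp M pstate :=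
  let! (st, _) := foreach rows (st, Some k) (fun _ '(st, cur) =>
    if cur is Some k then
      let! p := read pred k in
      if p is Some i then
        let! r := read (rstar st) i in
        if r is Some j then
          let! st := place_star st k j in ret (st, Some i)
        else ret (st, None)
      else
        let! r := read rm k in
        if r is Some j then
          let! st := place_star st k j in ret (st, None)
        else ret (st, None)
    else ret (st, None)) in
  bump_nstar st.

Definition raise_value (st : pstate) mx (third : {ffun 'I_s -> bool}) : comp M M :=
  let! m := foreach rows None (fun i acc =>
    let! t := read third i in
    if t then
      foreach cols acc (fun j acc =>
        let! c := read (cstar st) j in
        let! b := if c is Some k then
                    let! t := read third k in ret (~~ t)
                  else ret true in
        if b then
          let! m := readM mx j in
          let! x := shifted (incr st) i j in
          let! d := sub m x in
          if acc is Some y then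
            let! b := leM d y in ret (Some (if b then d else y))
          else ret (Some d)
        else ret acc)
    else ret acc) in
  ret (odflt 0 m).

Definition raise (st : pstate) (third : {ffun 'I_s -> bool}) (d : M) :
    comp M pstate :=
  let! l := foreach rows (incr st) (fun i l =>
    let! t := read third i in
    if t then
      let! x := readM l i in
      let! y := add x d in
      writeM l i y
    else ret l) in
  ret (PState l (rstar st) (cstar st) (nstar st)).

(* One iteration of the main loop; [inr] exits the loop. *)
Definition loop_body (st : pstate) : comp M (pstate + {ffun 'I_s -> M}) :=
  let! _ := tick in
  if nstar st == s then ret (inr (incr st)) else
  let! mx := col_maxima (incr st) in
  let! o := lower_right_max st mx in
  if o is Some (i, j) then
    let! st := place_star st i j in
    let! st := bump_nstar st in
    ret (inl st)
  else
  let! rm := right_maxima st mx in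
  let! (seen, pred) := search_class1 st rm in
  let! o := first_some rows (fun k =>
    let! r := read (rstar st) k in
    let! b := read seen k in
    ret (if ~~ isSome r && b then Some k else None)) in
  if o is Some k then
    let! st := augment st rm pred k in ret (inl st)
  else
  let! third := search_class3 st in
  let! d := raise_value st mx third in
  let! st := raise st third d in
  ret (inl st).

(* Big-step semantics of the main loop: starting from [st], it performs the
   operations [t], goes through the states [sts] (the first of which is [st])
   and returns [l]. *)
Inductive loop_exec (st : pstate) :
    seq (op M) -> seq pstate -> {ffun 'I_s -> M} -> Prop :=
| loop_exit t l : loop_body st = (t, inr l) -> loop_exec st t [:: st] l
| loop_next t st' t' sts l :
    loop_body st = (t, inl st') -> loop_exec st' t' sts l ->
    loop_exec st (t ++ t') (st :: sts) l.

Inductive jacobi_exec : seq (op M) -> seq pstate -> {ffun 'I_s -> M} -> Prop :=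
| exec_trivial t l :
    s = 1%N -> (let! _ := tick in alloc 'I_s 0) = (t, l) ->
    jacobi_exec t [::] l
| exec_main t st t' sts l :
    s <> 1%N -> (let! _ := tick in init) = (t, st) ->
    loop_exec st t' sts l ->
    jacobi_exec (t ++ t') sts l.

(* The execution through the states [sts] with result [l] is a run of the
   algorithm. *)
Definition implements_run (sts : seq pstate) l : Prop :=
  jacobi_run A Start (rcons (map pconfig sts) (Done l)).

End Program.

Definition elementary_cost (M : porderZmodType) (t : seq (op M)) : nat := size t.

(* Number of binary digits of [`|x|]. *)
Definition bitsize (x : int) : nat := (trunc_log 2 `|x|%N).+1.

Definition op_bits (o : op int) : nat :=
  match o with
  | Add x y | Sub x y | Cmp x y => (bitsize x + bitsize y)%N
  | Move x => bitsize x
  | Book => 1%N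
  end.

Definition bit_cost (t : seq (op int)) : nat := (\sum_(o <- t) op_bits o)%N.

(* Main.v *)
Require Import Defs.
From mathcomp Require Import all_boot all_order all_algebra reals exp.
From mathcomp Require Import zify.
Set Implicit Arguments.
Unset Strict Implicit.
Unset Printing Implicit Defensive.
Import Order.TTheory GRing.Theory Num.Theory.
Import Defs.

(** Write [B] for the current matrix [A + l] and [T] for the set of starred
elements.

Correctness.  Throughout, [T] consists of transversal maxima of [B], and [l] is
non-negative and lies below every canon ([loop_inv], preserved by [step_inv]);
hence as soon as [#|T| = s] the vector [l] is the least canon.  The first
increments lie below a canon [l'] because row [i] of [A + l'] contains an element
which is at least as large as the whole column of [A] in which it stands.  For a
raise by [d] ([raise_le_canon]), let [W] be the set of third class rows [i] with
[l' i < l i + d].  By the choice of [d], a row of [W] can be maximal in [A + l']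
only in a column whose star stands in [W].  The canon [l'] provides distinct such
columns for the rows of [W]; so every row of [W] is upper, and every column
starred in [W] is one of those provided.  But a path from a row of [W] to a lower
row leaves [W] somewhere, and in the starred column where it does so no row of [W]
can be maximal.  Hence [W] is empty.

Termination.  As long as no third class row contains a right maximum, a raise
either makes the third class larger or creates a right maximum in one of its rows
([raise_rank]); in the latter case the next step adds a star.  So there are at
most [s + 2] steps for each value of [#|T|], and O(s^2) steps in all.

Cost.  The triple [spec P m c Q] bounds by [c] the number of operations of the
computation [m], keeps their operands in [P], and ensures [Q] for the value of
[m].  One iteration of the main loop takes O(s n) operations, because a graph
search looks at each pair of rows at most once, and it performs a step of the
algorithm ([spec_loop_body]).  This gives both O(s^3 n) operations and the fact
that the algorithm is never stuck before it returns ([loop_progress]).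

Bit operations.  By minimality some entry of the minimal canon is zero, and then
the column of the star of that row bounds all the other entries by the largest
entry of [A] ([minimal_canon_le]).  All the increments lie below the minimal
canon, so that every operand has absolute value at most [2 * C]: an operation on
elements costs O(log C). *)

Local Open Scope ring_scope.

(** * Translation-invariant total orders *)

Section OrderedGroup.
Variable M : porderZmodType.
Hypothesis M_total : total (<=%R : rel M).
Hypothesis M_lerD : forall x y z : M, x <= y -> x + z <= y + z.
Implicit Types x y z t : M.

Lemma leD2r z x y : (x + z <= y + z) = (x <= y).
Proof.
apply/idP/idP => [|/M_lerD //]; move/(M_lerD (- z)); by rewrite !addrK.
Qed.

Lemma leD2l z x y : (z + x <= z + y) = (x <= y).
Proof. by rewrite !(addrC z) leD2r. Qed.

Lemma leBl z x y : (x - z <= y) = (x <= z + y).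
Proof. by rewrite -(leD2r z (x - z)) subrK (addrC y). Qed.

Lemma le_sub0 x y : (0 <= y - x) = (x <= y).
Proof. by rewrite -(leD2r x 0) add0r subrK. Qed.

Lemma nleW x y : ~~ (x <= y) -> y <= x.
Proof. by case/orP: (M_total x y) => // ->. Qed.

Lemma ex_max_fin (I : finType) (f : I -> M) (i0 : I) :
  exists i, forall k, f k <= f i.
Proof.
have [i _ Hi] := @extremumP _ I (fun x y => y <= x) i0 predT f
  (fun x => lexx x) (fun y x z Hy Hz => le_trans Hz Hy)
  (fun x y => M_total y x) isT.
by exists i => k; apply: Hi.
Qed.

Lemma ex_max_col s n (B : 'M[M]_(s, n)) (i0 : 'I_s) j : exists i, is_max B i j.
Proof. by have [i Hi] := ex_max_fin (fun k => B k j) i0; exists i; apply/forallP. Qed.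

End OrderedGroup.

(** * Transversal maxima and augmenting paths *)

Section Transversals.
Variables (M : porderZmodType) (s n : nat).
Implicit Types (B : 'M[M]_(s, n)) (T : {set 'I_s * 'I_n}).

Lemma shiftE (A : 'M[M]_(s, n)) l i j : shift A l i j = A i j + l i.
Proof. by rewrite mxE. Qed.

Lemma card_upper B T :
  transversal_maxima B T -> #|[set i | upper_row T i]| = #|T|.
Proof.
case=> Hf _ _; rewrite -(card_in_imset Hf); apply: eq_card => i.
rewrite !inE; apply/existsP/imsetP => [[j Hj]|[[k j] Hj /= ->]]; last by exists j.
by exists (i, j).
Qed.

Lemma card_left B T :
  transversal_maxima B T -> #|[set j | left_col T j]| = #|T|.
Proof.
case=> _ Hf _; rewrite -(card_in_imset Hf); apply: eq_card => j.
rewrite !inE; apply/existsP/imsetP => [[i Hj]|[[k i] Hj /= ->]]; last by exists k.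
by exists (i, j).
Qed.

Lemma card_transversal B T : transversal_maxima B T -> (#|T| <= s)%N.
Proof. by move/card_upper=> <-; rewrite -[X in (_ <= X)%N]card_ord max_card. Qed.

Lemma ex_lower B T : transversal_maxima B T -> (#|T| < s)%N ->
  exists i, ~~ upper_row T i.
Proof.
move=> HT lts; apply/existsP; rewrite -negb_forall; apply/negP => /forallP H.
move: lts; rewrite -(card_upper HT) (_ : [set i | _] = setT) ?cardsT ?card_ord ?ltnn //.
by apply/setP=> i; rewrite !inE H.
Qed.

Lemma ex_right B T : transversal_maxima B T -> (#|T| < n)%N ->
  exists j, ~~ left_col T j.
Proof.
move=> HT lts; apply/existsP; rewrite -negb_forall; apply/negP => /forallP H.
move: lts; rewrite -(card_left HT) (_ : [set i | _] = setT) ?cardsT ?card_ord ?ltnn //.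
by apply/setP=> i; rewrite !inE H.
Qed.

Lemma full_upper B T : transversal_maxima B T -> #|T| = s ->
  forall i, upper_row T i.
Proof.
move=> HT cT; have /eqP: [set i | upper_row T i] == setT.
  by rewrite eqEcard subsetT cardsT card_ord (card_upper HT) cT /=.
by move/setP => H i; have := H i; rewrite !inE.
Qed.

Lemma add_transversal B T i j : transversal_maxima B T ->
  ~~ upper_row T i -> right_max B T i j ->
  transversal_maxima B ((i, j) |: T) /\ #|(i, j) |: T| = #|T|.+1.
Proof.
move=> [H1 H2 H3] Hi /andP[Hj Hm].
have Ni q : q \in T -> q.1 != i.
  case: q => k c Hq /=; apply: contraNneq Hi => <-; by apply/existsP; exists c.
have Nj q : q \in T -> q.2 != j.
  case: q => k c Hq /=; apply: contraNneq Hj => <-; by apply/existsP; exists k.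
split; last first.
  rewrite cardsU1 (_ : _ \notin T) //; apply/negP => /Ni /=; by rewrite eqxx.
split=> [p q|p q|p].
- move=> /setU1P[->|Hp] /setU1P[->|Hq] //=; [by move=> E; have := Ni _ Hq; rewrite -E eqxx
    |by move=> E; have := Ni _ Hp; rewrite E eqxx|exact: H1].
- move=> /setU1P[->|Hp] /setU1P[->|Hq] //=; [by move=> E; have := Nj _ Hq; rewrite -E eqxx
    |by move=> E; have := Nj _ Hp; rewrite E eqxx|exact: H2].
- by move=> /setU1P[->|Hp] //; apply: H3.
Qed.

Lemma switch_nil T i j : ~~ upper_row T i -> switch T i [::] j = (i, j) |: T.
Proof.
move=> Hi; apply/setP=> q; rewrite !inE /=.
suff -> : [exists i0, ((i0, q.1) \in [::]) && ((i0, q.2) \in T)] = false.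
  by rewrite andbT orbF.
by apply/existsP=> -[].
Qed.

(** Switching along a path can be done one edge at a time: once the star of [i0]
has been moved to [j0], its former column [c] has become a right column and
contains a maximum in row [i1], the next row of the path. *)
Lemma switch_cons T i0 i1 p j0 c : {in T &, injective (@fst 'I_s 'I_n)} ->
  (i0, c) \in T -> uniq (i0 :: i1 :: p) ->
  switch T i0 (i1 :: p) j0 = switch ((i0, j0) |: (T :\ (i0, c))) i1 p c.
Proof.
move=> inj Hc /= /andP[N0 _]; apply/setP=> q; rewrite !inE /=.
have N0b : i0 \notin belast i1 p.
  by apply: contra N0 => H; rewrite lastI mem_rcons inE H orbT.
have starc k : ((i0, k) \in T) = (k == c).
  by apply/idP/eqP => [H|-> //]; have [] := inj _ _ H Hc erefl.
have -> : [exists i, ((i, q.1) \in (i0, i1) :: zip (belast i1 p) p) && ((i, q.2) \in T)]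
   = (q == (i1, c)) || [exists i, ((i, q.1) \in zip (belast i1 p) p) &&
        ((i, q.2) \in (i0, j0) |: (T :\ (i0, c)))].
  have zipN i k : (i, k) \in zip (belast i1 p) p -> i != i0.
    move=> H; apply: contraNneq N0b => <-.
    have := map_f fst H; rewrite -/unzip1 unzip1_zip ?size_belast //.
  apply/existsP/orP => [[i /andP[]]|[/eqP->|/existsP[i /andP[H1 H2]]]].
  - rewrite inE => /orP[/eqP[-> E1]|H1] H2.
      by left; move: H2; rewrite starc => /eqP E2; rewrite -E1 -E2 -surjective_pairing.
    right; apply/existsP; exists i; rewrite H1 !inE H2 andbT /=.
    by apply/orP; right; rewrite xpair_eqE (negPf (zipN _ _ H1)).
  - by exists i0; rewrite /= starc eqxx inE eqxx.
  - exists i; rewrite inE H1 orbT /=; move: H2; rewrite !inE !xpair_eqE.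
    by rewrite (negPf (zipN _ _ H1)).
set E := [exists _, _].
have -> : (q \in T) && (q.1 \notin i0 :: belast i1 p) =
   (q != (i0, c)) && (q \in T) && (q.1 \notin belast i1 p).
  case: q {E} => a b /=; rewrite inE negb_or xpair_eqE.
  case: eqP => [->|] /=; last by [].
  rewrite starc; by case: eqP => //=; rewrite ?andbF.
have : (q == (i0, j0)) = (q == (i0, j0)) && (q.1 \notin belast i1 p).
  by case: eqP => [->|//] /=; rewrite N0b.
by clearbody E; case: (q == (i0, j0)); case: (q == (i1, c)); case: E; case: (q.1 \notin
    _); case: (q != _); case: (_ \in _).
Qed.

(** By induction on the path with [switch_cons]; the last row of the path is lower,
so that the last move adds a star. *)
Lemma switch_transversal B T i0 p j0 : transversal_maxima B T ->
  right_max B T i0 j0 -> path (elem_path B T) i0 p -> uniq (i0 :: p) ->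
  ~~ upper_row T (last i0 p) ->
  transversal_maxima B (switch T i0 p j0) /\ #|switch T i0 p j0| = #|T|.+1.
Proof.
elim: p T i0 j0 => [|i1 p IH] T i0 j0 HT rm.
  by move=> _ _ /= low; rewrite switch_nil //; apply: add_transversal.
case/andP=> /existsP[c /andP[Hc /eqP Ec]] Hp U low.
have [H1 H2 H3] := HT.
rewrite (switch_cons j0 H1 Hc U); set T1 := _ |: _.
have [N0 U1] : i0 \notin i1 :: p /\ uniq (i1 :: p) by move: U => /= /andP[].
have Nj0 k : (k, j0) \notin T.
  by case/andP: rm => Nj _; apply: contra Nj => H; apply/existsP; exists k.
have cT1 : #|T1| = #|T|.
  rewrite /T1 cardsU1 !inE (negPf (Nj0 _)) andbF add1n /=.
  by rewrite [RHS](cardsD1 (i0, c)) Hc.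
have N1 k j : (k, j) \in T1 -> k != i0 -> (k, j) \in T.
  by rewrite !inE xpair_eqE => /orP[/andP[/eqP->]|/andP[_ ->] //]; rewrite eqxx.
have starc k : (i0, k) \in T -> k = c.
  by move=> H; have [] := H1 _ _ H Hc erefl.
have rm1 : right_max B T1 i1 c.
  apply/andP; split.
    apply/negP => /existsP[k]; rewrite !inE !xpair_eqE => /orP[/andP[_ /eqP E]|].
      by move: (Nj0 i0); rewrite -E Hc.
    rewrite eqxx andbT => /andP[/negP Nk Hk]; apply: Nk.
    by have [->] := H2 _ _ Hk Hc erefl.
  by apply/forallP => k; rewrite Ec; move/forallP: (H3 _ Hc); apply.
rewrite -cT1; apply: IH => //.
- split=> [[a b] [a' b']|[a b] [a' b']|q]; rewrite !inE.
  + case/orP=> [/eqP[-> ->]|/andP[Na Ha]]; case/orP=> [/eqP[-> ->]|/andP[Na' Ha']] //= E.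
    * by move: Na' Ha'; rewrite -E => + /starc Eb; rewrite Eb eqxx.
    * by move: Na Ha; rewrite E => + /starc Eb; rewrite Eb eqxx.
    * exact: H1.
  + case/orP=> [/eqP[-> ->]|/andP[Na Ha]]; case/orP=> [/eqP[-> ->]|/andP[Na' Ha']] //= E.
    * by move: Ha'; rewrite -E (negPf (Nj0 _)).
    * by move: Ha; rewrite E (negPf (Nj0 _)).
    * exact: H2.
  + by case/orP=> [/eqP->|/andP[_ /H3 //]]; case/andP: rm.
- apply: (sub_in_path (P := [in i1 :: p]) _ _ Hp); last exact: allss.
  move=> i k Hi _ /existsP[j /andP[Hj Ej]]; apply/existsP; exists j; rewrite Ej andbT.
  rewrite !inE Hj andbT !xpair_eqE (_ : (i == i0) = false) ?orbT //.
  by apply: contraNF N0 => /eqP Ei; rewrite -Ei; exact: Hi.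
- apply: contra low => /existsP[j Hj]; apply/existsP; exists j; apply: N1 Hj _.
  by apply: contraNneq N0 => <-; rewrite mem_last.
Qed.

End Transversals.

(** * Raising the third class *)

Section Raising.
Variable M : porderZmodType.
Hypothesis M_total : total (<=%R : rel M).
Hypothesis M_lerD : forall x y z : M, x <= y -> x + z <= y + z.
Variables (s n : nat).
Implicit Types (A B : 'M[M]_(s, n)) (l : {ffun 'I_s -> M}).
Implicit Types (T : {set 'I_s * 'I_n}).

Lemma class3_lower B T i : ~~ upper_row T i -> class3 B T i.
Proof. by move=> Hi; apply/existsP; exists i; rewrite Hi connect0. Qed.

Lemma class3_edge B T i k : elem_path B T i k -> class3 B T k -> class3 B T i.
Proof.
move=> e /existsP[r /andP[Hr c]]; apply/existsP; exists r; rewrite Hr.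
exact: connect_trans (connect1 e) c.
Qed.

(** Induction along a path to a lower row. *)
Lemma class3_ind B T (P : 'I_s -> Prop) :
  (forall i, ~~ upper_row T i -> P i) ->
  (forall i k, elem_path B T i k -> class3 B T i -> class3 B T k -> P k -> P i) ->
  forall i, class3 B T i -> P i.
Proof.
move=> Plow Pe i /existsP[k /andP[Hk /connectP[p Hp Ek]]].
suff [_ //] : class3 B T i /\ P i.
elim: p i Hp Ek => [|k1 p IH] i /=.
  by move=> _ <-; split; [apply: class3_lower | apply: Plow].
case/andP=> e Hp Ek; have [c3 Pk1] := IH _ Hp Ek.
have c3i := class3_edge e c3; split=> //; exact: Pe e c3i c3 Pk1.
Qed.

Definition no_lower_right_max B T :=
  forall i j, ~~ upper_row T i -> ~~ right_max B T i j.
Definition no_lower_class1 B T := forall i, ~~ upper_row T i -> ~~ class1 B T i.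

Definition raised A l T d : {ffun 'I_s -> M} :=
  [ffun i => if class3 (shift A l) T i then l i + d else l i].

(** A row in both classes would lie on a path from a right maximum to a lower
row, which would then be of the first class. *)
Lemma class13_disjoint B T i :
  no_lower_class1 B T -> class1 B T i -> ~~ class3 B T i.
Proof.
move=> H2 /existsP[r /and3P[Ur Mr Cr]]; apply/negP => /existsP[k /andP[Hk Ck]].
case/negP: (H2 _ Hk); apply/existsP; exists r; rewrite Ur Mr /=.
exact: connect_trans Cr Ck.
Qed.

Lemma right_max_class3 B T i j :
  no_lower_right_max B T -> no_lower_class1 B T ->
  right_max B T i j -> ~~ class3 B T i.
Proof.
move=> H1 H2 Hm; have Ui : upper_row T i.
  by case: (boolP (upper_row T i)) => // N; have := H1 _ j N; rewrite Hm.
apply: (class13_disjoint H2); apply/existsP; exists i; rewrite Ui connect0 andbT.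
by apply/existsP; exists j.
Qed.

Section Step.
Variables (A : 'M[M]_(s, n)) (l : {ffun 'I_s -> M}) (T : {set 'I_s * 'I_n}) (d : M).
Let B := shift A l.
Hypothesis HT : transversal_maxima B T.
Hypothesis H1 : no_lower_right_max B T.
Hypothesis H2 : no_lower_class1 B T.
Hypothesis Hd : least (raise_candidate B T) d.
Let l1 := raised A l T d.
Let B1 := shift A l1.

Lemma raised_entry i j : B1 i j = if class3 B T i then B i j + d else B i j.
Proof. by rewrite !shiftE ffunE; case: ifP; rewrite ?addrA. Qed.

(** This and the next lemma are the leastness of [d]: raising a third class row by
[d] does not bring it above the maxima that bound the raise. *)
Lemma raise_star i k j : class3 B T i -> (k, j) \in T -> ~~ class3 B T k ->
  B i j + d <= B k j.
Proof.
move=> Ci Hk Nk; rewrite -(subrK (B i j) (B k j)) addrC (leD2r M_lerD).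
apply: (proj2 Hd); exists i, j, k; split=> //; last by rewrite addrC subrK.
by apply/orP; right; rewrite Hk /class2 Nk andbT orbN.
Qed.

Lemma raise_right i k j : class3 B T i -> right_max B T k j ->
  B i j + d <= B k j.
Proof.
move=> Ci Hk; rewrite -(subrK (B i j) (B k j)) addrC (leD2r M_lerD).
apply: (proj2 Hd); exists i, j, k; split=> //; last by rewrite addrC subrK.
by rewrite Hk.
Qed.

Lemma raise_ge0 : 0 <= d.
Proof.
have [[i [j [k [Ci Hk E]]]] _] := Hd.
rewrite -(leD2l M_lerD (B i j)) addr0 E.
case/orP: Hk => [/andP[_ /forallP //]|/andP[Hk _]].
by have [_ _ /(_ _ Hk) /forallP] := HT; apply.
Qed.

Lemma raise_transversal : transversal_maxima B1 T.
Proof.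
have [inj1 inj2 Hm] := HT; split=> // -[k j] Hk; apply/forallP => i /=.
have := forallP (Hm _ Hk) i; rewrite !raised_entry /=.
case: (boolP (class3 B T i)) => Ci; case: (boolP (class3 B T k)) => Ck Le //.
- by rewrite (leD2r M_lerD).
- exact: raise_star.
- by apply: le_trans Le _; rewrite -{1}(addr0 (B k j)) (leD2l M_lerD) raise_ge0.
Qed.

Lemma raise_ge i : l i <= l1 i.
Proof.
rewrite ffunE; case: ifP => // _.
by rewrite -{1}(addr0 (l i)) (leD2l M_lerD) raise_ge0.
Qed.

(** The counting argument which makes the result minimal.  [W] is the set of the
third class rows that [l'] raises too little, and [f] chooses a maximum of
[A + l'] in each row, in distinct columns. *)
Lemma raise_le_canon l' : canon A l' -> (forall i, l i <= l' i) ->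
  forall i, l1 i <= l' i.
Proof.
case=> _ [T' HT' cT'] Hl.
pose W := [set i | class3 B T i && ~~ (l i + d <= l' i)].
have inW i : i \in W -> class3 B T i /\ forall j, A i j + l' i < B i j + d.
  rewrite inE => /andP[Ci Ni]; split=> // j.
  rewrite shiftE -addrA lt_neqAle (leD2l M_lerD) (nleW M_total Ni) andbT.
  by apply: contraNneq Ni => /addrI ->.
suff W0 : W = set0.
  move=> i; rewrite ffunE; case: ifP => // Ci.
  by have := in_set0 i; rewrite -W0 inE Ci /=; case: (_ <= _).
pose TW := [set q in T | q.1 \in W].
pose J := [set q.2 | q in TW].
have [f Hf] : exists f : 'I_s -> 'I_n, forall i, (i, f i) \in T'.
  have U i : exists j, (i, j) \in T' by apply/existsP; apply: full_upper HT' cT' i.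
  by exists (fun i => xchoose (U i)) => i; apply: (xchooseP (U i)).
have [inj1' inj2' Hm'] := HT'; have [inj1 inj2 Hm] := HT.
have fmax i k : A k (f i) + l' k <= A i (f i) + l' i.
  by have := forallP (Hm' _ (Hf i)) k; rewrite !shiftE.
have lt_contra i k x : i \in W -> B i (f i) + d <= x -> x <= A k (f i) + l' k -> False.
  move=> /inW[_ /(_ (f i)) lt1] le1 le2.
  have := lt_le_trans lt1 (le_trans le1 (le_trans le2 (fmax i k))).
  by rewrite ltxx.
have leB k j : B k j <= A k j + l' k by rewrite shiftE (leD2l M_lerD).
have fJ i : i \in W -> f i \in J.
  move=> Wi; have [Ci _] := inW _ Wi; apply/negPn/negP => NJ.
  case: (boolP (left_col T (f i))) => [/existsP[k Hk]|Nl].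
    (* A star outside [W] stays above the rows of [W] in [A + l']: it is either
       unraised, or raised by at least [d]. *)
    have NWk : k \notin W.
      apply: contra NJ => Wk; apply/imsetP; exists (k, f i) => //.
      by rewrite inE Hk.
    case: (boolP (class3 B T k)) => Ck; last first.
      by apply: (lt_contra i k _ Wi (raise_star Ci Hk Ck)).
    have le_k : l k + d <= l' k by move: NWk; rewrite inE Ck /= negbK.
    apply: (lt_contra i k (B k (f i) + d) Wi).
      by rewrite (leD2r M_lerD); have := forallP (Hm _ Hk) i.
    by rewrite shiftE -addrA (leD2l M_lerD).
  have [k Hk] := ex_max_col M_total B i (f i).
  apply: (lt_contra i k _ Wi (raise_right Ci _)) (leB _ _).
  by rewrite /right_max Nl Hk.
have injf : injective f.
  by move=> i k E; have [] := inj2' _ _ (Hf i) (Hf k) E.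
have sub1 : f @: W \subset J by apply/subsetP=> _ /imsetP[i Wi ->]; apply: fJ.
have cTW2 : #|J| = #|TW|.
  apply: card_in_imset => p q; rewrite !inE => /andP[Hp _] /andP[Hq _]; exact: inj2.
have cTW1 : #|[set q.1 | q in TW]| = #|TW|.
  apply: card_in_imset => p q; rewrite !inE => /andP[Hp _] /andP[Hq _]; exact: inj1.
have sub2 : [set q.1 | q in TW] \subset W.
  by apply/subsetP=> _ /imsetP[q + ->]; rewrite inE => /andP[].
have cle := subset_leq_card sub2; have cge := subset_leq_card sub1.
rewrite (card_imset _ injf) in cge.
(* All these sets have the same size, because [#|W| <= #|J| <= #|W|]. *)
have EJ : f @: W = J.
  by apply/eqP; rewrite eqEcard sub1 cTW2 (card_imset _ injf) -cTW1.
have EW : [set q.1 | q in TW] = W.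
  by apply/eqP; rewrite eqEcard sub2 cTW1 -cTW2.
apply/eqP/set0Pn => -[i Wi]; have [Ci _] := inW _ Wi.
(* Walk towards a lower row until the walk leaves [W]. *)
move: i Ci Wi; apply: class3_ind => [i Li|i k e Ci Ck IH Wi].
  rewrite -EW => /imsetP[[i' j]]; rewrite inE => /andP[/= Hq _] Ei.
  by case/existsP: Li; exists j; rewrite Ei.
case/existsP: e => j /andP[Hj /eqP Ej].
have le_k : l k + d <= l' k.
  by apply/negPn/negP => N; apply: IH; rewrite inE Ck N.
have : j \in J by apply/imsetP; exists (i, j) => //; rewrite inE Hj.
rewrite -EJ => /imsetP[r Wr Ejr].
apply: (lt_contra r k (B k j + d) Wr).
  by rewrite (leD2r M_lerD) -Ejr Ej; have := forallP (Hm _ Hj) r.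
by rewrite -Ejr shiftE -addrA (leD2l M_lerD).
Qed.

Definition class3_right B T := [exists i, class3 B T i && [exists j, right_max B T i j]].

(** Bounds the number of raises before the next star: every raise but the last
enlarges the third class, and the last one creates a right maximum in it. *)
Definition phase_rank B T : nat :=
  if class3_right B T then 0 else #|[set i | ~~ class3 B T i]|.+1.

(** Paths between third class rows survive, all their rows being raised by the
same amount. *)
Lemma raise_class3 i : class3 B T i -> class3 B1 T i.
Proof.
move: i; apply: class3_ind => [i /class3_lower //|i k e Ci Ck].
apply: class3_edge; case/existsP: e => j /andP[Hj /eqP Ej].
by apply/existsP; exists j; rewrite Hj !raised_entry Ci Ck Ej /=.
Qed.

(** The raise by [d] creates an equality in some column between a raised row [i] and
a row [k] that is not raised.  Either this column is right and [i] receives a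
right maximum, or it contains the star of [k] and [k] joins the third class. *)
Lemma raise_rank : (phase_rank B1 T < phase_rank B T)%N.
Proof.
have N3 : class3_right B T = false.
  apply/existsP => -[i /andP[Ci /existsP[j Hj]]].
  by have := right_max_class3 H1 H2 Hj; rewrite Ci.
rewrite /phase_rank N3; case: ifP => // N3'; rewrite ltnS.
have [[i [j [k [Ci /orP[Hk|/andP[Hk Ck]] E]]]] _] := Hd.
  case/negP: (negbT N3'); apply/existsP; exists i; rewrite raise_class3 //=.
  apply/existsP; exists j; have /andP[Hj /forallP Hm] := Hk; rewrite /right_max Hj /=.
  apply/forallP => r; rewrite !raised_entry Ci E.
  by case: ifP => // Cr; apply: raise_right.
have Nk : ~~ class3 B T k.
  by case/orP: Ck => [/(class13_disjoint H2) //|/andP[]].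
apply: proper_card; apply/properP; split.
  by apply/subsetP=> r; rewrite !inE; apply/contra/raise_class3.
exists k; rewrite !inE ?Nk // negbK.
apply: (class3_edge _ (raise_class3 Ci)); apply/existsP; exists j.
by rewrite Hk !raised_entry Ci (negPf Nk) E /=.
Qed.

End Step.
End Raising.

(** * Invariant and termination of the algorithm *)

Section Abstract.
Variable M : porderZmodType.
Hypothesis M_total : total (<=%R : rel M).
Hypothesis M_lerD : forall x y z : M, x <= y -> x + z <= y + z.
Variables (s n : nat).
Hypothesis hs : (1 <= s <= n)%N.
Variable A : 'M[M]_(s, n).
Implicit Types (l : {ffun 'I_s -> M}) (T : {set 'I_s * 'I_n}).

(** The part of the invariant that bounds the increments; it also bounds all the
operands of the execution. *)
Definition below_canons l :=
  (forall i, 0 <= l i) /\ (forall l', canon A l' -> forall i, l i <= l' i).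

Definition loop_inv l T := transversal_maxima (shift A l) T /\ below_canons l.

Definition config_inv (c : config M s n) : Prop :=
  match c with
  | Start => True
  | Loop l T => loop_inv l T
  | Done l => minimal_canon A l
  end.

Lemma below_canons0 : below_canons [ffun=> 0].
Proof. by split=> [i|l' [l'0 _] i]; rewrite ffunE. Qed.

Lemma minimal_canon_row : s = 1%N -> minimal_canon A [ffun=> 0].
Proof.
move=> s1; have [pos le] := below_canons0; split=> //; split=> //.
have j : 'I_n by apply: (Ordinal (n := n) (m := 0)); move: hs; lia.
have i0 : 'I_s by apply: (Ordinal (n := s) (m := 0)); move: hs; lia.
have one (i k : 'I_s) : i = k.
  by apply: ord_inj; have := ltn_ord i; have := ltn_ord k; lia.
exists [set (i0, j)]; last by rewrite cards1.
split=> [p q|p q|p]; rewrite !inE; [by move=> /eqP-> /eqP->..|move=> /eqP-> /=].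
by apply/forallP => k; rewrite (one k i0).
Qed.

(** In [A + l'] every row contains a maximum of its column, and this element is at
least as large as all the elements of [A] in that column. *)
Lemma init_below_canons l :
  (forall i, least (fun x => exists j,
       greatest (fun y => exists k, y = A k j - A i j) x) (l i)) ->
  below_canons l.
Proof.
move=> Hl; split=> [i|l' [l'0 [T' HT' cT']] i].
  have [[j [_ Hj]] _] := Hl i; apply: Hj; exists i; by rewrite subrr.
have /existsP[j Hj] := full_upper HT' cT' i.
have [k /forallP Hk] := ex_max_col M_total A i j.
have [_ _ /(_ _ Hj) /forallP Hm] := HT'.
apply: (@le_trans _ _ (A k j - A i j)).
  apply: (proj2 (Hl i)); exists j; split; first by exists k.
  by move=> _ [r ->]; rewrite (leD2r M_lerD).
rewrite (leBl M_lerD); apply: le_trans (_ : A k j + l' k <= _).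
  by rewrite -{1}(addr0 (A k j)) (leD2l M_lerD).
by have := Hm k; rewrite !shiftE.
Qed.

Lemma return_minimal l T : loop_inv l T -> #|T| = s -> minimal_canon A l.
Proof. by case=> HT [pos le] cT; split=> //; split=> //; exists T. Qed.

Lemma raise_below_canons l T d (B := shift A l) :
  transversal_maxima B T -> no_lower_right_max B T -> no_lower_class1 B T ->
  least (raise_candidate B T) d -> below_canons l -> below_canons (raised A l T d).
Proof.
move=> HT H1 H2 Hd [pos le]; split=> [i|l' Hl']; last first.
  exact: raise_le_canon Hl' (le _ Hl').
by apply: le_trans (pos i) (raise_ge M_lerD HT Hd i).
Qed.

Lemma step_inv c c' : config_inv c -> jacobi_step A c c' -> config_inv c'.
Proof.
move=> inv st; case: st inv => /=.
- by move=> /minimal_canon_row.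
- by move=> l T _ Hl HT _ _; split=> //; apply: init_below_canons.
- move=> l T i j _ Hi Hj [HT bc]; split=> //.
  by case: (add_transversal HT Hi Hj).
- move=> l T i0 p j0 lts _ _ Hm Hp U low [HT bc]; split=> //.
  by case: (switch_transversal HT Hm Hp U low).
- move=> l T d lts H1 H2 Hd [HT bc]; split; first exact: raise_transversal.
  exact: raise_below_canons.
- by move=> l T cT inv; apply: return_minimal inv cT.
Qed.

(** The factor [s.+2] exceeds every value of [phase_rank], so that a new star is
worth any change of the classes. *)
Definition loop_rank l T : nat :=
  ((s - #|T|) * s.+2 + phase_rank (shift A l) T)%N.

Lemma phase_rank_le (B : 'M[M]_(s, n)) T : (phase_rank B T <= s.+1)%N.
Proof.
rewrite /phase_rank; case: ifP => // _; rewrite ltnS.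
by rewrite -[X in (_ <= X)%N]card_ord max_card.
Qed.

Lemma loop_rank_le l T : (loop_rank l T <= s * s.+2 + s.+1)%N.
Proof. by rewrite leq_add ?phase_rank_le // leq_mul2r leq_subr orbT. Qed.

Lemma grow_rank l T l' T' : (#|T| < s)%N -> #|T'| = #|T|.+1 ->
  (loop_rank l' T' < loop_rank l T)%N.
Proof.
clear hs; move=> lts cT'; rewrite /loop_rank cT' -(subnSK lts) mulSn.
have := phase_rank_le (shift A l') T'; lia.
Qed.

Lemma step_rank l T l' T' : loop_inv l T ->
  jacobi_step A (Loop l T) (Loop l' T') -> (loop_rank l' T' < loop_rank l T)%N.
Proof.
move=> [HT bc] st; inversion st; subst.
- by apply: grow_rank => //; have [] := add_transversal HT H4 H5.
- by apply: grow_rank => //; have [] := switch_transversal HT H6 H7 H8 H9.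
- by rewrite /loop_rank ltn_add2l; apply: raise_rank.
Qed.

Lemma terminates_Start : terminates A.
Proof.
have accD l : Acc (fun c' c => jacobi_step A c c') (Done l).
  by constructor=> c st; inversion st.
have accL l T : loop_inv l T -> Acc (fun c' c => jacobi_step A c c') (Loop l T).
  have [r] := ubnP (loop_rank l T); elim: r l T => [|r IH] l T lt_r inv.
    by move: lt_r; rewrite ltn0.
  constructor=> -[|l' T'|l'] st; last exact: accD; first by inversion st.
  apply: IH; last exact: (step_inv (c := Loop l T) inv st).
  move: (step_rank inv st) => lt_l; exact: leq_trans lt_l _.
constructor=> -[|l T|l] st; last exact: accD; first by inversion st.
by apply: accL; apply: (step_inv (c := Start) I st).
Qed.

Lemma run_inv c cs : config_inv c -> jacobi_run A c cs -> config_inv (last c cs).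
Proof.
by elim: cs c => //= c' cs IH c inv [st run]; apply: IH run; apply: step_inv inv st.
Qed.

End Abstract.

(** * Cost and operands of computations *)

Local Open Scope comp_scope.

Lemma dims_bounds s n : (1 <= s <= n)%N ->
  [/\ 0 < s * n, s <= s * n, n <= s * n & s * s <= s * n]%N.
Proof. by move=> hs; split; move: hs; nia. Qed.

Section CostLogic.
Variables (M : porderZmodType) (P : pred M).

Definition op_ok (o : op M) : bool :=
  match o with
  | Add x y | Sub x y | Cmp x y => P x && P y
  | Move x => P x
  | Book => true
  end.

(** A Hoare triple with a cost.  In [spec_bind] the cost of the first computation
is subtracted from the budget, so that a program is followed from its first
operation to its last with what remains of the budget. *)
Definition spec X (m : comp M X) (c : nat) (Q : X -> Prop) : Prop :=
  [/\ (size m.1 <= c)%N, all op_ok m.1 & Q m.2].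

Lemma spec_ret X (x : X) c (Q : X -> Prop) : Q x -> spec (ret x) c Q.
Proof. by split. Qed.

Lemma spec_weak X (m : comp M X) c c' (Q Q' : X -> Prop) :
  spec m c Q -> (c <= c')%N -> (forall x, Q x -> Q' x) -> spec m c' Q'.
Proof. by case=> H1 H2 H3 le HQ; split; [apply: leq_trans le | | apply: HQ]. Qed.

Lemma spec_bind X Y (m : comp M X) (f : X -> comp M Y) c1 c Q1 Q :
  spec m c1 Q1 -> (c1 <= c)%N -> (forall x, Q1 x -> spec (f x) (c - c1) Q) ->
  spec (bind m f) c Q.
Proof.
case=> H1 H2 H3 le /(_ _ H3)[K1 K2 K3]; split=> //=.
  by rewrite size_cat -(subnKC le) leq_add.
by rewrite all_cat H2.
Qed.

Lemma spec_bind_eq X Y (m : comp M X) (f : X -> comp M Y) v c1 c Q :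
  spec m c1 (eq v) -> (c1 <= c)%N -> spec (f v) (c - c1) Q -> spec (bind m f) c Q.
Proof. by move=> Hm le Hf; apply: spec_bind Hm le _ => x <-. Qed.

Lemma spec_value X (m : comp M X) c (Q : X -> Prop) v :
  spec m c Q -> m.2 = v -> spec m c (eq v).
Proof. by case. Qed.

Lemma spec_tick : spec (@tick M) 1 (eq tt). Proof. by []. Qed.

Lemma spec_add x y : P x -> P y -> spec (add x y) 1 (eq (x + y)).
Proof. by move=> Px Py; split; rewrite //= Px Py. Qed.

Lemma spec_sub x y : P x -> P y -> spec (sub x y) 1 (eq (x - y)).
Proof. by move=> Px Py; split; rewrite //= Px Py. Qed.

Lemma spec_leM x y : P x -> P y -> spec (leM x y) 1 (eq (x <= y)).
Proof. by move=> Px Py; split; rewrite //= Px Py. Qed.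

Lemma spec_eqM x y : P x -> P y -> spec (eqM x y) 1 (eq (x == y)).
Proof. by move=> Px Py; split; rewrite //= Px Py. Qed.

Lemma spec_alloc (I : finType) X (x : X) : spec (@alloc M I X x) #|I| (eq [ffun=> x]).
Proof. by split; rewrite //= ?size_nseq ?all_nseq ?orbT. Qed.

Lemma spec_read (I : finType) X (f : {ffun I -> X}) i :
  spec (@read M I X f i) 1 (eq (f i)).
Proof. by []. Qed.

Lemma spec_write (I : finType) X (f : {ffun I -> X}) i x :
  spec (@write M I X f i x) 1 (eq (upd f i x)).
Proof. by []. Qed.

Lemma spec_readM (I : finType) (f : {ffun I -> M}) i :
  P (f i) -> spec (readM f i) 1 (eq (f i)).
Proof. by move=> Pf; split; rewrite //= Pf. Qed.

Lemma spec_writeM (I : finType) (f : {ffun I -> M}) i x :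
  P x -> spec (writeM f i x) 1 (eq (upd f i x)).
Proof. by move=> Px; split; rewrite //= Px. Qed.

Lemma spec_entry s n (A : 'M[M]_(s, n)) i j :
  P (A i j) -> spec (entry A i j) 1 (eq (A i j)).
Proof. by move=> Px; split; rewrite //= Px. Qed.

(** The invariant is indexed by the part of the list already treated. *)
Lemma spec_foreach (I : Type) X (Inv : seq I -> X -> Prop) r x body c :
  Inv [::] x ->
  (forall r1 i r2 y, r = r1 ++ i :: r2 -> Inv r1 y ->
     spec (body i y) c (Inv (rcons r1 i))) ->
  spec (foreach r x body) (size r * c.+1).+1 (Inv r).
Proof.
have from r0 r' : r = r0 ++ r' -> forall y, Inv r0 y ->
    (forall r1 i r2 y, r = r1 ++ i :: r2 -> Inv r1 y ->
       spec (body i y) c (Inv (rcons r1 i))) ->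
    spec (foreach r' y body) (size r' * c.+1).+1 (Inv r).
  elim: r' r0 => [|i r' IH] r0 Er y Hy Hb.
    apply: (spec_bind_eq spec_tick) => //; apply: spec_ret.
    by rewrite Er cats0.
  apply: (spec_bind_eq spec_tick); first by [].
  apply: (spec_bind (Hb r0 i r' y Er Hy)); first by rewrite /=; lia.
  move=> z Hz; apply: (spec_weak (IH (rcons r0 i) _ z Hz Hb)) => //.
    by rewrite cat_rcons.
  by rewrite /=; lia.
by move=> H0 Hb; apply: (from [::]).
Qed.

Lemma spec_first_some (I : eqType) Y (r : seq I) (f : I -> comp M (option Y)) c
    (R : I -> Y -> Prop) (N : I -> Prop) :
  (forall i, i \in r ->
     spec (f i) c (fun o => if o is Some y then R i y else N i)) ->
  spec (first_some r f) (size r * c.+1).+1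
    (fun o => if o is Some y then exists2 i, i \in r & R i y
              else forall i, i \in r -> N i).
Proof.
elim: r => [|i r IH] Hf /=.
  by apply: (spec_bind_eq spec_tick) => //; apply: spec_ret.
apply: (spec_bind_eq spec_tick); first by [].
apply: (spec_bind (Hf i _)); rewrite ?mem_head //=; first by lia.
move=> [y|] Hy; first by apply: spec_ret; exists i; rewrite ?mem_head.
apply: (spec_weak (IH _)) => [k Hk||[y [k Hk Rk]|HN k]].
- by apply: Hf; rewrite inE Hk orbT.
- by lia.
- by exists k; rewrite // inE Hk orbT.
- by rewrite inE => /orP[/eqP->|/HN].
Qed.

End CostLogic.

Lemma updE (I : finType) X (f : {ffun I -> X}) i x k :
  upd f i x k = if k == i then x else f k.
Proof. by rewrite ffunE. Qed.

Lemma enum_prefix (I : finType) (r1 r2 : seq I) i :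
  enum I = r1 ++ i :: r2 -> i \notin r1.
Proof.
move=> E; have := enum_uniq I; rewrite E cat_uniq => /and3P[_ + _] /=.
by rewrite negb_or => /andP[].
Qed.

Section Running.
Variables (M : Type) (R : rel M) (I : Type) (D : I -> M).

(** The accumulator of a loop that looks for a minimum or a maximum, according to
the order [R]; it is empty before the first element. *)
Definition running (S : I -> Prop) (acc : option M) : Prop :=
  if acc is Some y then (exists2 x, S x & y = D x) /\ forall x, S x -> R y (D x)
  else forall x, ~ S x.

Lemma running_ext S S' acc : (forall x, S x <-> S' x) ->
  running S acc -> running S' acc.
Proof.
move=> E; case: acc => [y [[x Sx ->] H]|H] /=.
  split; first by exists x => //; apply/E.
  by move=> z /E /H.
by move=> x /E /H.
Qed.

Lemma running_step S acc x z : transitive R -> running S acc ->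
  R z (D x) -> (if acc is Some y then R z y /\ (z = D x \/ z = y) else z = D x) ->
  running (fun w => S w \/ w = x) (Some z).
Proof.
move=> tr; case: acc => [y [[v Sv Ey] H] Rx [Ry Ez]|H Rx Ez] /=.
  split; last by move=> w [/H /(tr _ _ _ Ry) //|->].
  by case: Ez => ->; [exists x; [right|]|exists v; [left|]].
by split; [exists x; [right|]|move=> w [/H //|->]].
Qed.

End Running.

(** * Column maxima and the initial pair of maxima *)

Section Maxima.
Variable M : porderZmodType.
Hypothesis M_total : total (<=%R : rel M).
Hypothesis M_lerD : forall x y z : M, x <= y -> x + z <= y + z.
Variables (s n : nat).
Hypothesis hs : (1 <= s <= n)%N.
Variable A : 'M[M]_(s, n).
Variable P : pred M.
Implicit Types (l : {ffun 'I_s -> M}) (mx : {ffun 'I_n -> M}).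

(** Apart from the new increments that it writes, an iteration that starts from the
increments [l] meets only operands of these four forms. *)
Record tame l : Prop := Tame {
  tame_entry : forall i j, P (A i j);
  tame_incr : forall i, P (l i);
  tame_shift : forall i j, P (shift A l i j);
  tame_diff : forall i k j, P (shift A l k j - shift A l i j) }.

Definition col_max_at l mx : Prop :=
  forall j, exists2 k, is_max (shift A l) k j & mx j = shift A l k j.


Lemma spec_shifted l i j : tame l -> spec P (shifted A l i j) 3 (eq (shift A l i j)).
Proof.
move=> t; have [tA tl _ _] := t.
apply: (spec_bind_eq (spec_entry (tA i j))) => //.
apply: (spec_bind_eq (spec_readM (tl i))) => //.
rewrite shiftE; exact: (spec_weak (spec_add (tA i j) (tl i))).
Qed.

Lemma spec_col_max l j : tame l ->
  spec P (col_max A l j) (s * 5).+1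
    (fun m => exists2 k, is_max (shift A l) k j & m = shift A l k j).
Proof.
have [sn1 sn2 sn3 sn4] := dims_bounds hs.
move=> t; have tB := tame_shift t; rewrite /col_max.
set B := shift A l in tB *.
apply: spec_bind.
- apply: (@spec_foreach M P 'I_s _ (fun r acc =>
    running (>=%R : rel M) (fun i => B i j) (fun w => w \in r) acc) _ _ _ 4) => //.
  move=> r1 i r2 acc E Hacc.
  apply: (spec_bind_eq (spec_shifted i j t)) => //.
  have ext w : w \in r1 \/ w = i <-> w \in rcons r1 i.
    rewrite mem_rcons inE; split; first by case=> [->|->]; rewrite ?orbT ?eqxx.
    by case/orP=> [/eqP|]; [right|left].
  case: acc Hacc => [y|] Hacc; last first.
    apply: spec_ret; apply: (running_ext ext).
        by apply: (running_step ge_trans Hacc) => /=.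
  have [v _ Ey] : exists2 v, v \in r1 & y = B v j by case: Hacc.
  apply: (spec_bind_eq (spec_leM (tB i j) _)) => //; first by rewrite Ey.
  apply: spec_ret; apply: (running_ext ext); apply: (running_step ge_trans Hacc).
  + by case: ifP => //= /negbT /(nleW M_total).
  + case: ifP => //= [H|/negbT /(nleW M_total)]; first by split=> //; right.
    by split=> //; left.
- by rewrite size_enum_ord.
move=> [y|] /= H; apply: spec_ret.
  case: H => -[k _ ->] Hk; exists k => //; apply/forallP => i; apply: Hk.
  by rewrite mem_enum.
have i0 : 'I_s by apply: (Ordinal (n := s) (m := 0)); case/andP: hs.
by case: (H i0); rewrite mem_enum.
Qed.

Lemma spec_col_maxima l : tame l ->
  spec P (col_maxima A l) (10 * (s * n)) (col_max_at l).
Proof.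
have [sn1 sn2 sn3 sn4] := dims_bounds hs.
move=> t; rewrite /col_maxima.
apply: (spec_bind_eq (spec_alloc _ _ _)); first by rewrite card_ord; lia.
apply: spec_weak.
- apply: (@spec_foreach M P 'I_n _ (fun r mx => forall j, j \in r ->
    exists2 k, is_max (shift A l) k j & mx j = shift A l k j) _ _ _ ((s * 5).+2)) => //.
  move=> r1 j r2 mx E H.
  apply: (spec_bind (spec_col_max j t)); first by lia.
  move=> m [k Hk Em].
  apply: spec_weak; first by apply: (spec_writeM _ j (x := m)); rewrite Em; apply:
      tame_shift.
    by lia.
  move=> _ <- c; rewrite mem_rcons inE updE; case: eqP => [->|_ /= /H //] _.
  by exists k.
- rewrite size_enum_ord card_ord; lia.
- by move=> mx H j; apply: H; rewrite mem_enum.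
Qed.

Lemma col_max_ge l mx i j : col_max_at l mx -> shift A l i j <= mx j.
Proof. by move=> /(_ j)[k /forallP Hk ->]. Qed.

Lemma col_max_eq l mx i j : col_max_at l mx ->
  is_max (shift A l) i j = (shift A l i j == mx j).
Proof.
move=> H; have Hge := col_max_ge _ _ H; apply/forallP/eqP => [Hi|-> k //].
by apply: le_anti; rewrite Hge /=; case: (H j) => k _ ->.
Qed.

Lemma col_max_tame l mx j : tame l -> col_max_at l mx -> P (mx j).
Proof. by move=> t /(_ j)[k _ ->]; apply: tame_shift. Qed.

Lemma col_max_tame_diff l mx i j : tame l -> col_max_at l mx ->
  P (mx j - shift A l i j).
Proof. by move=> t /(_ j)[k _ ->]; apply: tame_diff. Qed.

Lemma spec_test_max l mx i j : tame l -> col_max_at l mx ->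
  spec P (test_max A l mx i j) 5 (eq (is_max (shift A l) i j)).
Proof.
move=> t Hmx; apply: (spec_bind_eq (spec_shifted i j t)) => //.
apply: (spec_bind_eq (spec_readM (col_max_tame j t Hmx))) => //.
rewrite (col_max_eq _ _ Hmx).
apply: (spec_weak (spec_eqM _ _)) => //; [exact: tame_shift|exact: col_max_tame Hmx].
Qed.

Definition least_increments l : Prop :=
  forall i, least (fun x => exists j,
       greatest (fun y => exists k, y = A k j - A i j) x) (l i).

Lemma spec_init_increments : tame [ffun=> 0] ->
  spec P (init_increments A) (20 * (s * n)) (fun l => least_increments l /\
    forall i, exists j, is_max (shift A l) i j).
Proof.
have [sn1 sn2 sn3 sn4] := dims_bounds hs.
move=> t; rewrite /init_increments.
have l0A i j : shift A [ffun=> 0] i j = A i j by rewrite shiftE ffunE addr0.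
apply: (spec_bind_eq (spec_alloc _ _ _)); first by rewrite card_ord; lia.
apply: (spec_bind (spec_col_maxima t)); first by rewrite card_ord; lia.
move=> mx Hmx.
have j0 : 'I_n by apply: (Ordinal (n := n) (m := 0)); move: hs; lia.
have tD i j : P (mx j - A i j) by rewrite -l0A; apply: col_max_tame_diff Hmx.
pose ok i x := (exists j, x = mx j - A i j) /\ forall j, x <= mx j - A i j.
apply: spec_weak.
- apply: (@spec_foreach M P 'I_s _ (fun r (l : {ffun 'I_s -> M}) => forall i, i \in r ->
    ok i (l i)) _ _ _ (n * 5).+2) => //.
  move=> r1 i r2 l E Hl.
  apply: spec_bind.
  + apply: (@spec_foreach M P 'I_n _ (fun r acc =>
      running (<=%R : rel M) (fun j => mx j - A i j) (fun w => w \in r) acc) _ _ _ 4)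
          => //.
    move=> c1 j c2 acc E' Hacc.
    apply: (spec_bind_eq (spec_readM (col_max_tame j t Hmx))) => //.
    apply: (spec_bind_eq (spec_entry (tame_entry t i j))) => //.
    apply: (spec_bind_eq (spec_sub (col_max_tame j t Hmx) (tame_entry t i j))) => //.
    have ext w : w \in c1 \/ w = j <-> w \in rcons c1 j.
      rewrite mem_rcons inE; split; first by case=> [->|->]; rewrite ?orbT ?eqxx.
      by case/orP=> [/eqP|]; [right|left].
    case: acc Hacc => [y|] Hacc; last first.
      apply: spec_ret; apply: (running_ext ext).
      by apply: (running_step le_trans Hacc) => /=.
    have [v _ Ey] : exists2 v, v \in c1 & y = mx v - A i v by case: Hacc.
    apply: (spec_bind_eq (spec_leM (tD i j) _)) => //; first by rewrite Ey.
    apply: spec_ret; apply: (running_ext ext); apply: (running_step le_trans Hacc).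
    * by case: ifP => //= /negbT /(nleW M_total).
    * case: ifP => //= [H|/negbT /(nleW M_total)]; first by split=> //; left.
      by split=> //; right.
  + by rewrite size_enum_ord.
  move=> acc Hacc.
  have Hok : ok i (odflt 0 acc).
    case: acc Hacc => [y [[j _ Ey] Hy]|Hn] /=; last by case: (Hn j0); rewrite mem_enum.
    by split; [exists j|move=> k; apply: Hy; rewrite mem_enum].
  apply: spec_weak; first by apply: (spec_writeM _ i (x := odflt 0 acc)); case: Hok =>
      -[j ->].
    by rewrite size_enum_ord; lia.
  move=> _ <- k; rewrite mem_rcons inE updE; case: eqP => [->|_ /= /Hl //] _.
  exact: Hok.
- rewrite size_enum_ord card_ord; lia.
move=> l Hl; have {}Hl i : ok i (l i) by apply: Hl; rewrite mem_enum.
have gr i j : greatest (fun y => exists k, y = A k j - A i j) (mx j - A i j).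
  split; first by have [k _ ->] := Hmx j; exists k; rewrite l0A.
  by move=> _ [k ->]; rewrite (leD2r M_lerD) -l0A col_max_ge.
split=> i; have [[j Ej] Hle] := Hl i.
  split; first by exists j; rewrite Ej; apply: gr.
  move=> x [c [[k ->] Hx]]; apply: le_trans (Hle c) _.
  by apply: Hx; have [[r ->] _] := gr i c; exists r.
exists j; apply/forallP => k; rewrite !shiftE Ej (addrC (A i j)) subrK.
have [_ Hk] := Hl k; have := Hk j; rewrite -(leD2l M_lerD (A k j) (l k)).
by rewrite (addrC _ (mx j - _)) subrK.
Qed.

Lemma spec_max_in_row l mx i : tame l -> col_max_at l mx ->
  spec P (max_in_row A l mx i) (n * 6).+1
    (fun o => if o is Some j then is_max (shift A l) i j
              else forall j, ~~ is_max (shift A l) i j).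
Proof.
move=> t Hmx; apply: spec_weak.
- apply: (@spec_first_some M P _ _ _ _ 5 (fun j c => j = c /\ is_max (shift A l) i j)
     (fun j => ~~ is_max (shift A l) i j)).
  move=> j _; apply: (spec_bind_eq (spec_test_max i j t Hmx)) => //.
  by apply: spec_ret; case: ifP => // /negbT.
- by rewrite size_enum_ord; lia.
move=> [j [c _ [-> //]]|H j]; by apply: H; rewrite mem_enum.
Qed.

(** If all the rows have their first maximum in column [j1], then all of column [j1]
is maximal, and any maximum of another column can be completed by an element of
column [j1] in another row. *)
Lemma spec_two_maxima l mx : (1 < s)%N -> tame l -> col_max_at l mx ->
  (forall i, exists j, is_max (shift A l) i j) ->
  spec P (two_maxima A l mx) (50 * (s * n))
    (fun o => if o is Some (p, q) then
       [/\ is_max (shift A l) p.1 p.2, is_max (shift A l) q.1 q.2,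
           p.1 <> q.1 & p.2 <> q.2] else False).
Proof.
have [sn1 sn2 sn3 sn4] := dims_bounds hs.
move=> s1 t Hmx Hrow; rewrite /two_maxima; set B := shift A l in Hrow *.
have i0 : 'I_s by apply: (Ordinal (n := s) (m := 0)); case/andP: hs.
have := size_enum_ord s; have := enum_uniq 'I_s.
have := fun i => mem_enum 'I_s i.
case E: (enum 'I_s) => [|i1 rs] /= mem_rs; first by move=> _ s0; lia.
case/andP=> [N1 _] sz.
have szr : (size rs < s)%N := eq_leq sz.
have le_sz c : ((size rs).+1 * c < (s * c).+1)%N by rewrite ltnS leq_mul2r szr orbT.
apply: (spec_bind (spec_max_in_row i1 t Hmx)); first by lia.
case=> [j1 Hj1|H]; last by have [j] := Hrow i1; rewrite (negPf (H j)).
apply: (spec_bind (c1 := (s * (n * 6).+2)%N)).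
- apply: spec_weak; first apply: (@spec_first_some M P _ _ rs _ ((n * 6).+1)
    (fun i pq => [/\ pq = ((i1, j1), (i, pq.2.2)), is_max B i pq.2.2 & pq.2.2 != j1])
    (fun i => is_max B i j1)).
  move=> i Hi; apply: (spec_bind (spec_max_in_row i t Hmx)) => //.
  case=> [j Hj|H]; last by have [j] := Hrow i; rewrite (negPf (H j)).
  by apply: spec_ret; case: eqP => [<-|/eqP].
  + by rewrite ltn_mul2r szr.
  + by move=> x Hx; exact: Hx.
- by lia.
case=> [[p q]|].
  case=> i Hi [/= -> Hm Nj]; apply: spec_ret; split=> //= [Ei|Ej].
    by move: N1; rewrite Ei Hi.
  by move: Nj; rewrite Ej eqxx.
move=> Hrs; have Hall i : is_max B i j1.
  have := mem_rs i; rewrite inE => /orP[/eqP-> //|]; exact: Hrs.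
apply: spec_bind.
- apply: (@spec_first_some M P _ _ _ _ 0 (fun j c => j = c /\ j != j1) (fun j => j = j1)).
  by move=> j _; apply: spec_ret; case: eqP => // /eqP.
- by rewrite size_enum_ord; lia.
case=> [j [_ _ [-> Nj]]|Hj]; last first.
  have ord0n : (0 < n)%N by move: hs; lia.
  have ord1n : (1 < n)%N by move: hs; lia.
  have E0 := Hj (Ordinal ord0n) (mem_enum _ _).
  have E1 := Hj (Ordinal ord1n) (mem_enum _ _).
  by move: E1; rewrite -E0.
apply: (spec_bind (c1 := (s * 6).+1)).
- apply: spec_weak; first apply: (@spec_first_some M P _ _ (i1 :: rs) _ 5 (fun i c => i
    = c /\ is_max B i j)
     (fun i => ~~ is_max B i j)).
  move=> i _; apply: (spec_bind_eq (spec_test_max i j t Hmx)) => //.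
  by apply: spec_ret; case: ifP => // /negbT.
  + exact: le_sz.
  + by move=> x Hx; exact: Hx.
- by rewrite ?size_enum_ord; lia.
case=> [i [_ _ [-> Hi]]|Hi]; last first.
  have [k Hk] := ex_max_col M_total B i0 j.
  by have := Hi k; rewrite Hk => /(_ _) /negP []; rewrite // -E mem_enum.
apply: (spec_bind (c1 := (s * 1).+1)).
- apply: spec_weak; first apply: (@spec_first_some M P _ _ (i1 :: rs) _ 0 (fun k c => k
    = c /\ k != i) (fun k => k = i)).
  by move=> k _; apply: spec_ret; case: eqP => // /eqP.
  + exact: le_sz.
  + by move=> x Hx; exact: Hx.
- by rewrite ?size_enum_ord; lia.
case=> [k [_ _ [-> Nk]]|Hk].
  apply: spec_ret; split=> //=; first by move=> Ek; move: Nk; rewrite Ek eqxx.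
  by move=> Ej; move: Nj; rewrite Ej eqxx.
have ord0s : (0 < s)%N by lia.
have E0 := Hk (Ordinal ord0s) (mem_rs _).
have E1 := Hk (Ordinal s1) (mem_rs _).
by move: E1; rewrite -E0.
Qed.

End Maxima.

(** * Stars of a state and right maxima *)

Section States.
Variables (M : porderZmodType) (s n : nat).
Implicit Types (st : pstate M s n).

Definition stars st : {set 'I_s * 'I_n} := [set p | rstar st p.1 == Some p.2].
(** The two tables of stars are inverse of each other. *)
Definition linked st : Prop :=
  forall i j, (cstar st j == Some i) = (rstar st i == Some j).
Definition well_formed st : Prop := linked st /\ nstar st = #|stars st|.

Lemma in_stars st i j : ((i, j) \in stars st) = (rstar st i == Some j).
Proof. by rewrite inE. Qed.

Lemma upper_stars st i : upper_row (stars st) i = isSome (rstar st i).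
Proof.
apply/existsP/idP => [[j]|]; first by rewrite in_stars => /eqP->.
by case E: (rstar st i) => [j|] // _; exists j; rewrite in_stars E.
Qed.

Lemma left_stars st j : linked st -> left_col (stars st) j = isSome (cstar st j).
Proof.
move=> L; apply/existsP/idP => [[i]|]; first by rewrite in_stars -L => /eqP->.
by case E: (cstar st j) => [i|] // _; exists i; rewrite in_stars -L E.
Qed.

Definition set_star st (p : 'I_s * 'I_n) : pstate M s n :=
  PState (incr st) (upd (rstar st) p.1 (Some p.2))
    (upd (cstar st) p.2 (Some p.1)) (nstar st).

Definition count_star st : pstate M s n :=
  PState (incr st) (rstar st) (cstar st) (nstar st).+1.

Variable P : pred M.

Lemma spec_place_star st i j : spec P (place_star st i j) 2 (eq (set_star st (i, j))).
Proof. by []. Qed.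

Lemma spec_bump_nstar st : spec P (bump_nstar st) 1 (eq (count_star st)).
Proof. by []. Qed.

Lemma stars_set_star st i j : rstar st i = None ->
  stars (set_star st (i, j)) = (i, j) |: stars st.
Proof.
move=> Ei; apply/setP=> -[k c]; rewrite in_stars updE !inE /= xpair_eqE.
case: (eqVneq k i) => [->|] //=; rewrite Ei orbF.
by apply/eqP/eqP => [[]|->].
Qed.

Lemma linked_set_star st i j : linked st -> rstar st i = None -> cstar st j = None ->
  linked (set_star st (i, j)).
Proof.
move=> L Ei Ej k c; rewrite /= !updE; have := L k c.
case: (eqVneq c j) => [->|Nc]; case: (eqVneq k i) => [->|Nk] //.
- by rewrite !eqxx.
- by rewrite Ej => <-; apply/eqP => -[E]; rewrite E eqxx in Nk.
- by rewrite Ei => ->; symmetry; apply/eqP => -[E]; rewrite E eqxx in Nc.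
Qed.

Lemma well_formed_add st i j : well_formed st ->
  rstar st i = None -> cstar st j = None -> well_formed (count_star (set_star st (i, j))).
Proof.
case=> L c Ei Ej; split; first exact: linked_set_star.
rewrite [nstar _]/= c -[stars (count_star _)]/(stars (set_star st (i, j)))
    stars_set_star //.
by rewrite cardsU1 in_stars Ei.
Qed.

End States.

Section RightMaxima.
Variable M : porderZmodType.
Hypothesis M_total : total (<=%R : rel M).
Hypothesis M_lerD : forall x y z : M, x <= y -> x + z <= y + z.
Variables (s n : nat).
Hypothesis hs : (1 <= s <= n)%N.
Variable A : 'M[M]_(s, n).
Variable P : pred M.
Variables (st : pstate M s n) (mx : {ffun 'I_n -> M}).
Let B := shift A (incr st).
Let T := stars st.
Hypothesis st_linked : linked st.
Hypothesis st_tame : tame A P (incr st).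
Hypothesis mx_max : col_max_at A (incr st) mx.

Lemma spec_row_right_max i :
  spec P (row_right_max A st mx i) (n * 7).+1
    (fun o => if o is Some j then right_max B T i j
              else forall j, ~~ right_max B T i j).
Proof.
apply: spec_weak.
- apply: (@spec_first_some M P _ _ _ _ 6 (fun j c => j = c /\ right_max B T i j)
     (fun j => ~~ right_max B T i j)).
  move=> j _; apply: (spec_bind_eq (spec_read _ _ _)) => //.
  rewrite /right_max left_stars //.
  case: (cstar st j) => [k|]; first exact: spec_ret.
  apply: (spec_bind_eq (spec_test_max i j st_tame mx_max)) => //.
  by apply: spec_ret; case: ifP => //= /negbT.
- by rewrite size_enum_ord; lia.
move=> [j [c _ [-> //]]|H j]; by apply: H; rewrite mem_enum.
Qed.

Lemma spec_lower_right_max :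
  spec P (lower_right_max A st mx) (12 * (s * n))
    (fun o => if o is Some (i, j) then ~~ upper_row T i /\ right_max B T i j
              else no_lower_right_max B T).
Proof.
have [sn1 sn2 sn3 sn4] := dims_bounds hs.
apply: spec_weak.
- apply: (@spec_first_some M P _ _ _ _ (n * 7).+2
     (fun i q => [/\ q.1 = i, ~~ upper_row T i & right_max B T i q.2])
     (fun i => ~~ upper_row T i -> forall j, ~~ right_max B T i j)).
  move=> i _; apply: (spec_bind_eq (spec_read _ _ _)) => //.
  rewrite upper_stars; case: (rstar st i) => [k|]; first exact: spec_ret.
  apply: (spec_bind (spec_row_right_max i)); first by lia.
  by case=> [j Hj|H]; apply: spec_ret.
- rewrite size_enum_ord; lia.
move=> [[i j] [_ _ [/= <-]] //|H i j Hi]; by apply: H => //; rewrite mem_enum.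
Qed.

Definition right_max_table (rm : {ffun 'I_s -> option 'I_n}) : Prop :=
  forall i, if rm i is Some j then (right_max B T i j : Prop)
            else forall j, ~~ right_max B T i j.

Lemma spec_right_maxima :
  spec P (right_maxima A st mx) (12 * (s * n)) right_max_table.
Proof.
have [sn1 sn2 sn3 sn4] := dims_bounds hs.
apply: (spec_bind_eq (spec_alloc _ _ _)); first by rewrite card_ord; lia.
apply: spec_weak.
- apply: (@spec_foreach M P 'I_s _ (fun r (rm : {ffun 'I_s -> option 'I_n}) =>
    forall i, i \in r -> if rm i is Some j then (right_max B T i j : Prop)
            else forall j, ~~ right_max B T i j) _ _ _ (n * 7).+2) => //.
  move=> r1 i r2 rm E H.
  apply: (spec_bind (spec_row_right_max i)); first by lia.
  move=> o Ho; apply: (spec_weak (spec_write _ _ _ _)); first by lia.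
  move=> _ <- k; rewrite mem_rcons inE updE.
  by case: eqP => [->|_ /= /H //].
- rewrite size_enum_ord card_ord; lia.
- by move=> rm H i; apply: H; rewrite mem_enum.
Qed.

Lemma spec_test_edge i k :
  spec P (test_edge A st i k) 8 (eq (elem_path B T i k)).
Proof.
apply: (spec_bind_eq (spec_read _ _ _)) => //.
have -> : elem_path B T i k = if rstar st i is Some j then B k j == B i j else false.
  apply/existsP/idP => [[j /andP[]]|]; first by rewrite in_stars => /eqP ->.
  by case E: (rstar st i) => [j|] // H; exists j; rewrite in_stars E eqxx.
case: (rstar st i) => [j|]; last exact: spec_ret.
apply: (spec_bind_eq (spec_shifted i j st_tame)) => //.
apply: (spec_bind_eq (spec_shifted k j st_tame)) => //.
by apply: (spec_weak (spec_eqM _ _)) => //; exact: tame_shift.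
Qed.

End RightMaxima.

(** * Graph search *)

Section Search.
Variables (M : porderZmodType) (P : pred M) (s : nat).
Variables (root : 'I_s -> comp M bool) (edge : 'I_s -> 'I_s -> comp M bool).
Variables (rootb : pred 'I_s) (e : rel 'I_s) (cr ce : nat).
Hypothesis spec_root : forall k, spec P (root k) cr (eq (rootb k)).
Hypothesis spec_edge : forall i k, spec P (edge i k) ce (eq (e i k)).
Implicit Types (seen : {ffun 'I_s -> bool}) (pred : {ffun 'I_s -> option 'I_s}).
Implicit Types (stack : seq 'I_s).

(** Following [pred] backwards from the end of [p] gives the path from the root
[i0]; the walk ends at [i0], which has no predecessor. *)
Definition back_path pred i0 p : Prop :=
  [/\ rootb i0, path e i0 p, uniq (i0 :: p), pred i0 = None
    & path (fun i k => pred k == Some i) i0 p].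

Definition reached seen pred k : Prop :=
  exists i0 p, [/\ back_path pred i0 p, last i0 p = k & all seen (i0 :: p)].

(** A row is treated once it has left the stack: all its successors are then
seen. *)
Definition treated seen stack : {set 'I_s} := [set i | seen i && (i \notin stack)].

Definition search_inv seen pred stack : Prop :=
  [/\ forall k, k \in stack -> seen k, uniq stack,
      forall k, rootb k -> seen k & forall k, seen k -> reached seen pred k].

Definition search_ok seen pred : Prop :=
  (forall k, seen k = [exists r, rootb r && connect e r k]) /\
  (forall k, seen k -> exists i0 p, back_path pred i0 p /\ last i0 p = k).

Lemma back_path_upd pred k o i0 p : k \notin i0 :: p ->
  back_path pred i0 p -> back_path (upd pred k o) i0 p.
Proof.
move=> Nk [Hr Hp U Hn Hb].
have neq x : x \in i0 :: p -> (x == k) = false.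
  by move=> Hx; apply: contraNF Nk => /eqP <-.
split=> //; first by rewrite updE neq ?mem_head.
have {}neq x : x \in p -> (x == k) = false by move=> Hx; rewrite neq // inE Hx orbT.
elim: p i0 {Nk Hr Hp U Hn} Hb neq => //= k1 p IH i0 /andP[H1 H2] neq.
rewrite updE neq ?mem_head // H1 /=.
by apply: IH H2 _ => x Hx; apply: neq; rewrite inE Hx orbT.
Qed.

Lemma search_inv_push seen pred stack i k :
  search_inv seen pred stack -> seen i -> ~~ seen k -> e i k ->
  search_inv (upd seen k true) (upd pred k (Some i)) (k :: stack).
Proof.
move=> [Hsub Hu Hr Hc] Si Nk Eik; split.
- by move=> x; rewrite inE updE; case: eqP => //= _; exact: Hsub.
- by rewrite /= Hu andbT; apply: contra Nk; apply: Hsub.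
- by move=> x /Hr; rewrite updE; case: eqP.
have fresh i0 p : all seen (i0 :: p) -> k \notin i0 :: p.
  by move=> Ha; apply: contra Nk => /(allP Ha).
have seen_upd i0 p : all seen (i0 :: p) -> all (upd seen k true) (i0 :: p).
  by move/allP=> Ha; apply/allP => x /Ha; rewrite updE; case: eqP.
move=> x; rewrite updE; case: eqP => [-> _|_ /Hc [i0 [p [Hb El Ha]]]]; last first.
  by exists i0, p; split=> //; [apply: back_path_upd; [exact: fresh|]|exact: seen_upd].
have [i0 [p [Hb El Ha]]] := Hc _ Si.
have [Hr' Hp U Hn Hq] := back_path_upd (Some i) (fresh _ _ Ha) Hb.
exists i0, (rcons p k); split; last 2 first.
- by rewrite last_rcons.
- by rewrite -rcons_cons all_rcons updE eqxx; apply: seen_upd.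
split=> //; first by rewrite rcons_path Hp El.
  by rewrite -rcons_cons rcons_uniq fresh.
by rewrite rcons_path Hq El updE eqxx /=.
Qed.

Lemma connect_closed seen r k : (forall i k, seen i -> e i k -> seen k) ->
  connect e r k -> seen r -> seen k.
Proof.
move=> cl /connectP[p Hp ->]; elim: p r Hp => //= k1 p IH r /andP[E Hp] Sr.
exact: IH Hp (cl _ _ Sr E).
Qed.

Lemma search_inv_ok seen pred : search_inv seen pred [::] ->
  (forall i k, seen i -> e i k -> seen k) -> search_ok seen pred.
Proof.
move=> [_ _ Hr Hc] cl; split; last first.
  by move=> k /Hc[i0 [p [Hb El _]]]; exists i0, p.
move=> k; apply/idP/existsP => [/Hc [i0 [p [[Hb Hp _ _ _] El _]]]|[r /andP[Rr Crk]]].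
  by exists i0; rewrite Hb; apply/connectP; exists p.
exact: connect_closed cl Crk (Hr _ Rr).
Qed.

(** While the successors of a row are pushed, the set of treated rows does not
change: this is what makes the number of rounds count the treated rows. *)
Lemma treated_push seen stack k : ~~ seen k ->
  treated (upd seen k true) (k :: stack) = treated seen stack.
Proof.
move=> Nk; apply/setP=> x; rewrite !inE updE negb_or.
by case: eqP => //= ->; rewrite (negPf Nk).
Qed.

Lemma treated_pop seen i stack : seen i -> uniq (i :: stack) ->
  treated seen stack = i |: treated seen (i :: stack).
Proof.
move=> Si /= /andP[Ni _]; apply/setP=> x; rewrite !inE negb_or.
by case: eqP => //= ->; rewrite Si.
Qed.

(** Each round treats one more row unless the stack is empty; after [s] rounds all
rows are treated or the stack is empty, and in both cases it is empty. *)
Lemma spec_search : spec P (search root edge)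
  (s * (s * (ce + 5) + cr + 10) + 10) (fun r => search_ok r.1 r.2).
Proof.
rewrite /search.
apply: (spec_bind_eq (spec_alloc _ _ _)); first by rewrite card_ord; lia.
apply: (spec_bind_eq (spec_alloc _ _ _)); first by rewrite card_ord; lia.
apply: spec_bind.
- apply: (@spec_foreach M P 'I_s _ (fun r (ss : {ffun 'I_s -> bool} * seq 'I_s) =>
    [/\ forall k, ss.1 k = (k \in r) && rootb k, uniq ss.2 &
      forall k, (k \in ss.2) = ss.1 k]) _ _ _ cr.+2).
  + by split=> // k; rewrite /= ffunE.
  + move=> r1 k r2 [seen stack] E [/= H1 H2 H3].
    apply: (spec_bind_eq (spec_root k)); first by lia.
    have Nk : ~~ seen k by rewrite H1 (negPf (enum_prefix E)).
    case Rk: (rootb k).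
      apply: (spec_bind_eq (spec_write _ _ _ _)); first by lia.
      apply: (spec_bind_eq (spec_tick _)); first by lia.
      apply: spec_ret; split=> /= [x||x].
      - by rewrite updE H1 mem_rcons inE; case: eqP => //= ->; rewrite Rk.
      - by rewrite H3 Nk.
      - by rewrite inE updE H3; case: eqP.
    apply: spec_ret; split=> // x; rewrite H1 mem_rcons inE.
    by case: eqP => [->|] //=; rewrite Rk andbF.
- by rewrite card_ord size_enum_ord; lia.
case=> [seen stack] [/= Hseen Ust Hst].
have inv0 : search_inv seen [ffun=> None] stack.
  split=> //; [by move=> k; rewrite Hst|by move=> k; rewrite Hseen mem_enum|].
  move=> k Sk; exists k, [::]; split=> //; last by rewrite /= Sk.
  by split; rewrite ?ffunE //; move: Sk; rewrite Hseen => /andP[].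
apply: spec_bind.
- apply: (@spec_foreach M P 'I_s _ (fun r (sps : {ffun 'I_s -> bool} * {ffun 'I_s ->
    option 'I_s} * seq 'I_s) =>
    let: (seen, pred, stack) := sps in
    [/\ search_inv seen pred stack,
        forall i k, i \in treated seen stack -> e i k -> seen k
      & stack = [::] \/ (size r <= #|treated seen stack|)%N]) _ _ _ (s * (ce + 5) + 2)).
  + split=> //; last by right.
    by move=> i k; rewrite inE Hst; case: (seen i).
  move=> r1 i1 r2 [[seen1 pred1] stack1] E [inv cl cnt].
  case: stack1 inv cl cnt => [|i stack1] inv cl cnt.
    by apply: spec_ret; split=> //; left.
  apply: (spec_bind_eq (spec_tick _)); first by lia.
  have [Hsub Us1 Hr Hc] := inv.
  have Si : seen1 i by apply: Hsub; rewrite mem_head.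
  have Hpop := treated_pop Si Us1.
  pose D := i |: treated seen1 (i :: stack1).
  apply: spec_weak.
  + apply: (@spec_foreach M P 'I_s _ (fun r (sps : {ffun 'I_s -> bool} * {ffun 'I_s ->
      option 'I_s} * seq 'I_s) =>
      let: (seen, pred, stack) := sps in
      [/\ search_inv seen pred stack, seen i, treated seen stack = D,
        forall x k, x \in D -> x != i -> e x k -> seen k
      & forall k, k \in r -> e i k -> seen k]) _ _ _ (ce + 4)).
    * split=> //; last first.
        by move=> x k; rewrite in_setU1 => /orP[->//|Hx _]; apply: cl.
      split=> //; last by case/andP: Us1.
      by move=> x Hx; apply: Hsub; rewrite inE Hx orbT.
    * move=> c1 k c2 [[seen2 pred2] stack2] E' [inv2 Si2 ED clD cli].
      apply: (spec_bind_eq (spec_read _ _ _)); first by lia.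
      case: (boolP (seen2 k)) => Sk.
        apply: spec_ret; split=> // x; rewrite mem_rcons inE => /orP[/eqP->//|].
        exact: cli.
      apply: (spec_bind_eq (spec_edge i k)); first by lia.
      case Eik: (e i k).
        apply: (spec_bind_eq (spec_write _ _ _ _)); first by lia.
        apply: (spec_bind_eq (spec_write _ _ _ _)); first by lia.
        apply: (spec_bind_eq (spec_tick _)); first by lia.
        apply: spec_ret; split.
        - exact: search_inv_push.
        - by rewrite updE Si2; case: eqP.
        - by rewrite treated_push.
        - by move=> x y Dx Nx Exy; rewrite updE (clD x y) //; case: eqP.
        - move=> y; rewrite mem_rcons inE updE; case: eqP => //= _; exact: cli.
      apply: spec_ret; split=> // x; rewrite mem_rcons inE => /orP[/eqP->|].
        by rewrite Eik.
      exact: cli.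
  + by rewrite size_enum_ord; lia.
  case=> [[seen' pred'] stack'] [inv' _ ED clD cli]; split=> //.
    move=> x k; rewrite ED => Dx; case: (eqVneq x i) => [->|Nx]; last exact: clD.
    by apply: cli; rewrite mem_enum.
  right; rewrite ED size_rcons /D cardsU1 !inE eqxx andbF add1n ltnS.
  by case: cnt => // ->.
- rewrite card_ord size_enum_ord; lia.
case=> [[seen1 pred1] stack1] [inv cl cnt]; apply: spec_ret.
(* If every row is treated, none is left on the stack. *)
have E0 : stack1 = [::].
  case: cnt => //; rewrite size_enum_ord => le.
  have /eqP Et : treated seen1 stack1 == setT.
    by rewrite eqEcard subsetT cardsT card_ord.
  case: stack1 {inv cl le} Et => // k stack1 /setP /(_ k).
  by rewrite !inE eqxx andbF.
apply: search_inv_ok; first by rewrite -E0.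
by move=> i k Si; apply: cl; rewrite E0 !inE Si.
Qed.

End Search.

(** * Augmentation along a path *)

Section PlaceAll.
Variables (M : porderZmodType) (s n : nat).
Implicit Types (st : pstate M s n) (us : seq ('I_s * 'I_n)).

Definition set_stars st us := foldr (fun u st' => set_star st' u) st us.

Lemma set_stars_incr st us : incr (set_stars st us) = incr st.
Proof. by elim: us. Qed.

Lemma set_stars_nstar st us : nstar (set_stars st us) = nstar st.
Proof. by elim: us. Qed.

Lemma set_stars_rstar st us i j : uniq (unzip1 us) ->
  (rstar (set_stars st us) i == Some j) =
    ((i, j) \in us) || (rstar st i == Some j) && (i \notin unzip1 us).
Proof.
elim: us => [|[k c] us IH] /=; first by rewrite andbT.
case/andP=> Nk U; rewrite updE /= !inE negb_or xpair_eqE; case: (eqVneq i k) => [->|_] /=.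
  rewrite andbF orbF (_ : (k, j) \in us = false) ?orbF.
    by apply/eqP/eqP => [[]|->].
  by apply: contraNF Nk => /(map_f fst).
exact: IH.
Qed.

Lemma set_stars_cstar st us i j : uniq (unzip2 us) ->
  (cstar (set_stars st us) j == Some i) =
    ((i, j) \in us) || (cstar st j == Some i) && (j \notin unzip2 us).
Proof.
elim: us => [|[k c] us IH] /=; first by rewrite andbT.
case/andP=> Nk U; rewrite updE /= !inE negb_or xpair_eqE andbC.
case: (eqVneq j c) => [->|_] /=; rewrite ?andbF ?andbT ?orbF.
  rewrite (_ : (i, c) \in us = false) ?orbF.
    by apply/eqP/eqP => [[]|->].
  by apply: contraNF Nk => /(map_f snd).
by rewrite /= IH.
Qed.

Lemma set_stars_linked st us : linked st -> uniq (unzip1 us) -> uniq (unzip2 us) ->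
  (forall i j, rstar st i = Some j -> (i \in unzip1 us) = (j \in unzip2 us)) ->
  linked (set_stars st us).
Proof.
move=> L U1 U2 H i j; rewrite set_stars_cstar // set_stars_rstar // L.
by case: eqP => //= /H ->.
Qed.

Lemma stars_set_stars st us : uniq (unzip1 us) ->
  stars (set_stars st us) = [set q | (q \in us) || (q \in stars st) && (q.1 \notin
      unzip1 us)].
Proof. by move=> U; apply/setP=> -[i j]; rewrite in_stars set_stars_rstar // !inE. Qed.

End PlaceAll.

Lemma foreach_value (M : porderZmodType) I X (r : seq I) (x : X)
    (body : I -> X -> comp M X) :
  (foreach r x body).2 = foldl (fun y i => (body i y).2) x r.
Proof. by elim: r x => //= i r IH x; rewrite IH. Qed.

Section Augment.
Variables (M : porderZmodType) (s n : nat) (P : pred M).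
Variables (st : pstate M s n) (rm : {ffun 'I_s -> option 'I_n}).
Variables (pred : {ffun 'I_s -> option 'I_s}) (i0 : 'I_s) (j0 : 'I_n).
Let c i := odflt j0 (rstar st i).
Hypothesis rm_root : rm i0 = Some j0.
Hypothesis pred_root : pred i0 = None.

(** The stars placed by an augmentation: [j0] in the root of the path, and in each
other row the former star column of its predecessor. *)
Definition moves p := zip (i0 :: p) (j0 :: [seq c i | i <- belast i0 p]).

Lemma moves_rcons p k : moves (rcons p k) = rcons (moves p) (k, c (last i0 p)).
Proof.
have E : [seq c i | i <- i0 :: p] = rcons [seq c i | i <- belast i0 p] (c (last i0 p)).
  by rewrite lastI map_rcons.
rewrite /moves belast_rcons E -!rcons_cons zip_rcons //=.
by rewrite size_map size_belast.
Qed.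

Lemma unzip1_moves p : unzip1 (moves p) = i0 :: p.
Proof. by rewrite unzip1_zip //= size_map size_belast. Qed.

Lemma unzip2_moves p : unzip2 (moves p) = j0 :: [seq c i | i <- belast i0 p].
Proof. by rewrite unzip2_zip //= size_map size_belast. Qed.

Definition retrace (_ : 'I_s) (x : pstate M s n * option 'I_s) :=
  let '(st, cur) := x in
  if cur is Some k then
      let! p := @read M _ _ pred k in
      if p is Some i then
        let! r := read (rstar st) i in
        if r is Some j then
          let! st := place_star st k j in ret (st, Some i)
        else ret (st, None)
      else
        let! r := read rm k in
        if r is Some j then
          let! st := place_star st k j in ret (st, None)
        else ret (st, None)
    else ret (st, None).

(** The walk handles the rows of the path from the last one to the root.  A row is
read before it receives its new star, hence the star read in the predecessor is
the original one. *)
Lemma retrace_value p st' (r : seq 'I_s) : (size p < size r)%N ->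
  path (fun i k => pred k == Some i) i0 p -> uniq (i0 :: p) ->
  {in belast i0 p, forall i, rstar st' i = Some (c i)} ->
  foldl (fun y i => (retrace i y).2) (st', Some (last i0 p)) r
    = (set_stars st' (moves p), None).
Proof.
have stop (r' : seq 'I_s) x : foldl (fun y i => (retrace i y).2) (x, None) r' = (x, None).
  by elim: r'.
elim/last_ind: p st' r => [|p k IH] st' [|x r] //.
  by move=> _ _ _ _ /=; rewrite pred_root /= rm_root /= stop.
rewrite size_rcons ltnS => lt_p; rewrite rcons_path => /andP[Hp /eqP Ek] U Hst.
rewrite -rcons_cons rcons_uniq in U; case/andP: U => Nk U.
rewrite moves_rcons last_rcons [foldl _ _ _]/= Ek /=.
have -> /= : rstar st' (last i0 p) = Some (c (last i0 p)).
  by apply: Hst; rewrite belast_rcons mem_last.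
rewrite [RHS](_ : _ = (set_stars (set_star st' (k, c (last i0 p))) (moves p), None)).
  apply: IH => // i Hi /=; rewrite updE; case: eqP => [Ei|_].
    by case/negP: Nk; rewrite -Ei lastI mem_rcons inE Hi orbT.
  by apply: Hst; rewrite belast_rcons lastI mem_rcons inE Hi orbT.
by rewrite /set_stars -cats1 foldr_cat.
Qed.

Variables (B : 'M[M]_(s, n)) (p : seq 'I_s).
Let T := stars st.
Hypothesis st_wf : well_formed st.
Hypothesis stars_max : transversal_maxima B T.
Hypothesis root_right : right_max B T i0 j0.
Hypothesis Hpath : path (elem_path B T) i0 p.
Hypothesis Hpred : path (fun i k => pred k == Some i) i0 p.
Hypothesis Hup : uniq (i0 :: p).
Hypothesis lower_last : ~~ upper_row T (last i0 p).

Lemma path_starred : {in belast i0 p, forall i, rstar st i = Some (c i)}.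
Proof.
elim: p i0 Hpath => //= k q IH i /andP[/existsP[j /andP[]]].
rewrite in_stars => /eqP Ei _ Hq x; rewrite inE => /orP[/eqP->|]; last exact: IH Hq x.
by rewrite /c Ei.
Qed.

Lemma moves_uniq1 : uniq (unzip1 (moves p)). Proof. by rewrite unzip1_moves. Qed.

Lemma cstar_root : cstar st j0 = None.
Proof.
case/andP: root_right; rewrite left_stars; last by case: st_wf.
by case: (cstar st j0).
Qed.

Lemma moves_uniq2 : uniq (unzip2 (moves p)).
Proof.
have [L _] := st_wf.
rewrite unzip2_moves /=; apply/andP; split.
  apply/negP => /mapP[i Hi Ej]; have := path_starred Hi; rewrite -Ej => /eqP.
  by rewrite -L cstar_root.
rewrite map_inj_in_uniq; last first.
  move=> i k Hi Hk Ec; have /eqP := path_starred Hi; have /eqP := path_starred Hk.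
  by rewrite Ec -!L => /eqP -> /eqP[].
by move: Hup; rewrite lastI rcons_uniq => /andP[].
Qed.

(** A star is removed as a star of its row exactly when it is removed as a star of
its column; so the two tables stay inverse of each other. *)
Lemma moves_cover i j : rstar st i = Some j ->
  (i \in unzip1 (moves p)) = (j \in unzip2 (moves p)).
Proof.
have [L _] := st_wf; move=> Ei; rewrite unzip1_moves unzip2_moves.
have Nl : (i == last i0 p) = false.
  by apply: contraNF lower_last => /eqP <-; rewrite upper_stars Ei.
rewrite lastI mem_rcons inE Nl /= inE.
have -> : (j == j0) = false.
  by apply/eqP => Ej; move/eqP: Ei; rewrite Ej -L cstar_root.
apply/idP/mapP => [Hi|[k Hk Ej]].
  by exists i => //; have := path_starred Hi; rewrite Ei => -[].
have /eqP := path_starred Hk; move/eqP: Ei; rewrite -Ej -!L => /eqP-> /eqP[->] //.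
Qed.

Lemma stars_moves : stars (set_stars st (moves p)) = switch T i0 p j0.
Proof.
rewrite stars_set_stars ?moves_uniq1 // unzip1_moves; apply/setP=> q.
rewrite in_set /switch in_setU1 in_setU [in X in _ || (X || _)]in_set [in X in _ || (_
    || X)]in_set.
have -> : (q \in moves p) = (q == (i0, j0)) ||
    [exists i, ((i, q.1) \in zip (belast i0 p) p) && ((i, q.2) \in T)].
  rewrite /moves /= inE; congr (_ || _).
  have -> : zip p [seq c i | i <- belast i0 p] =
      [seq (x.2, c x.1) | x <- zip (belast i0 p) p].
    by elim: p i0 => //= k q' IH i; rewrite IH.
  have zipb x : x \in zip (belast i0 p) p -> x.1 \in belast i0 p.
    by move/(map_f fst); rewrite -/unzip1 unzip1_zip ?size_belast.
  apply/mapP/existsP => [[[i k] Hx ->]|[i /andP[Hx]]].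
    by exists i; rewrite Hx in_stars (path_starred (zipb _ Hx)) /=.
  rewrite in_stars (path_starred (zipb _ Hx)) => /eqP[Eq].
  by exists (i, q.1) => //=; rewrite Eq -surjective_pairing.
have -> : (q \in T) && (q.1 \notin i0 :: p) = (q \in T) && (q.1 \notin belast i0 p).
  case: q => i j /=; rewrite lastI mem_rcons inE negb_or.
  case: (eqVneq i (last i0 p)) => [->|] //=; rewrite andbF.
  by symmetry; apply/negP => /andP[Hl _]; case/negP: lower_last; apply/existsP; exists j.
by rewrite -orbA; congr (_ || _); rewrite orbC.
Qed.

Lemma augment_wf : well_formed (count_star (set_stars st (moves p))).
Proof.
have [L E] := st_wf; split.
  apply: set_stars_linked => //; [exact: moves_uniq1|exact: moves_uniq2|exact:
      moves_cover].
rewrite [nstar _]/= set_stars_nstar E -[stars (count_star _)]/(stars (set_stars _ _))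
    stars_moves.
by have [_ ->] := switch_transversal stars_max root_right Hpath Hup lower_last.
Qed.

Lemma spec_augment k : last i0 p = k ->
  spec P (augment st rm pred k) (5 * s + 2) (eq (count_star (set_stars st (moves p)))).
Proof.
clear root_right lower_last; move=> El; rewrite /augment.
apply: (spec_bind_eq (v := (set_stars st (moves p), None)) (c1 := (5 * s + 1)%N)).
- apply: spec_value.
    apply: spec_weak.
    + apply: (@spec_foreach M P 'I_s _ (fun _ _ => True) _ _ _ 4) => //.
      move=> r1 i r2 [st1 [k1|]] _ _; last exact: spec_ret.
      apply: (spec_bind_eq (spec_read _ _ _)) => //.
      case: (pred k1) => [k2|].
        apply: (spec_bind_eq (spec_read _ _ _)) => //.
        by case: (rstar st1 k2) => [j|].
      apply: (spec_bind_eq (spec_read _ _ _)) => //.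
      by case: (rm k1) => [j|].
    + by rewrite size_enum_ord; lia.
    + by move=> x Hx; exact: Hx.
  rewrite foreach_value -El; apply: (retrace_value _ Hpred Hup path_starred).
  rewrite size_enum_ord -[X in (_ < X)%N]card_ord.
  by have /card_uniqP := Hup => /= <-; apply: max_card.
- by lia.
by apply: (spec_weak (spec_bump_nstar _ _)) => //; lia.
Qed.

End Augment.

(** * Amount of a raise *)

Section Raise.
Variable M : porderZmodType.
Hypothesis M_total : total (<=%R : rel M).
Hypothesis M_lerD : forall x y z : M, x <= y -> x + z <= y + z.
Variables (s n : nat).
Hypothesis hs : (1 <= s <= n)%N.
Variable A : 'M[M]_(s, n).
Variable P : pred M.
Variables (st : pstate M s n) (mx : {ffun 'I_n -> M}) (third : {ffun 'I_s -> bool}).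
Let B := shift A (incr st).
Let T := stars st.
Hypothesis st_linked : linked st.
Hypothesis st_tame : tame A P (incr st).
Hypothesis mx_max : col_max_at A (incr st) mx.
Hypothesis thirdE : forall i, third i = class3 B T i.
Hypothesis stars_max : transversal_maxima B T.
Hypothesis T_small : (#|T| < s)%N.
Hypothesis H1 : no_lower_right_max B T.
Hypothesis H2 : no_lower_class1 B T.


(** The pairs examined by the program, which replaces the row of the maximum in
[raise_candidate] by the column maximum. *)
Definition eligible (x : 'I_s * 'I_n) : bool :=
  third x.1 && (if cstar st x.2 is Some k then ~~ third k else true).

Let D (x : 'I_s * 'I_n) := mx x.2 - B x.1 x.2.

Lemma eligible_candidate x : eligible x -> raise_candidate B T (D x).
Proof.
case: x => i j /andP[/= Ci]; have [k Hk Ek] := mx_max j.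
have LC := left_stars j st_linked.
case Ej: (cstar st j) => [k'|] => [Nk|_]; last first.
  exists i, j, k; split; rewrite -?thirdE //; last by rewrite addrC subrK.
  by rewrite /right_max LC Ej Hk.
have Tk : (k', j) \in T by rewrite in_stars -st_linked Ej.
exists i, j, k'; split; rewrite -?thirdE //.
  by apply/orP; right; rewrite Tk /class2 -thirdE Nk andbT orbN.
rewrite addrC subrK; have [_ _ /(_ _ Tk)] := stars_max.
by rewrite (col_max_eq _ _ mx_max) => /eqP /= <-.
Qed.

Lemma candidate_eligible d : raise_candidate B T d -> exists2 x, eligible x & d = D x.
Proof.
move=> [i [j [k [Ci Hk E]]]]; have LC := left_stars j st_linked.
have Emx : is_max B k j.
  case/orP: Hk => [/andP[] //|/andP[Tk _]].
  by have [_ _ /(_ _ Tk)] := stars_max.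
move: Emx; rewrite (col_max_eq _ _ mx_max) => /eqP Emx.
exists (i, j); last by rewrite /D /= -Emx -/B -E addrC addKr.
rewrite /eligible /= thirdE Ci /=.
case/orP: Hk => [/andP[]|/andP[Tk Ck]]; first by rewrite LC; case: (cstar st j).
move: Tk; rewrite in_stars -st_linked => /eqP->; rewrite thirdE.
by case/orP: Ck => [/(class13_disjoint H2) //|/andP[]].
Qed.

Lemma spec_raise_value : spec P (raise_value A st mx third) (13 * (s * n))
  (fun d => least (raise_candidate B T) d /\ P d).
Proof.
have [sn1 sn2 sn3 sn4] := dims_bounds hs.
have tD x : P (D x) by apply: col_max_tame_diff mx_max.
apply: spec_bind.
- apply: (@spec_foreach M P 'I_s _ (fun r (acc : option M) =>
    running (<=%R : rel M) D (fun x => eligible x /\ x.1 \in r) acc) _ _ _ (n * 9).+2).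
  + by move=> x [].
  + move=> r1 i r2 acc E Hacc.
    apply: (spec_bind_eq (spec_read _ _ _)); first by lia.
    case Ci: (third i); last first.
      apply: spec_ret; apply: (running_ext _ Hacc) => x; rewrite mem_rcons inE.
      split=> -[Ex]; first by move=> ->; rewrite orbT.
      by case: eqP => //= Ei; move: Ex; rewrite /eligible Ei Ci.
    apply: spec_weak.
    * apply: (@spec_foreach M P 'I_n _ (fun r (acc : option M) =>
        running (<=%R : rel M) D
          (fun x => eligible x /\ (x.1 \in r1 \/ x.1 = i /\ x.2 \in r)) acc) _ _ _ 8).
        apply: (running_ext _ Hacc) => x; split=> -[Ex]; first by split; [|left].
        by case=> [//|[]].
      move=> c1 j c2 {Hacc}acc E' Hacc.
      apply: (spec_bind_eq (spec_read _ _ _)) => //.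
      apply: (spec_bind_eq (v := if cstar st j is Some k then ~~ third k else true) (c1
          := 1)) => //.
        case: (cstar st j) => [k|]; last exact: spec_ret.
        by apply: (spec_bind_eq (spec_read _ _ _)) => //; apply: spec_ret.
      have elE : eligible (i, j) = if cstar st j is Some k then ~~ third k else true.
        by rewrite /eligible /= Ci.
      have extend x : eligible (i, j) ->
        (eligible x /\ (x.1 \in r1 \/ x.1 = i /\ x.2 \in c1)) \/ x = (i, j) <->
        eligible x /\ (x.1 \in r1 \/ x.1 = i /\ x.2 \in rcons c1 j).
        move=> el; case: x => a b /=; rewrite mem_rcons inE; split.
          case=> [[Ex [Ha|[Ha Hb]]]|[-> ->]]; split=> //; [by left| |].
            by right; rewrite Hb orbT.
          by right; rewrite eqxx.
        case=> Ex [Ha|[Ea]]; first by left; split=> //; left.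
        by case/orP=> [/eqP Eb|Hb]; [right; rewrite Ea Eb|left; split=> //; right].
      rewrite -elE; case el: (eligible (i, j)); last first.
        apply: spec_ret; apply: (running_ext _ Hacc) => -[a b] /=; rewrite mem_rcons inE.
        split=> -[Ex [Ha|[Ea Hb]]]; split=> //; try by left.
          by right; rewrite Hb orbT.
        by move: Hb; case: eqP => [Eb|_ /=]; [move: Ex; rewrite Ea Eb el|right].
      apply: (spec_bind_eq (spec_readM (col_max_tame j st_tame mx_max))) => //.
      apply: (spec_bind_eq (spec_shifted i j st_tame)) => //.
      apply: (spec_bind_eq (spec_sub (col_max_tame j st_tame mx_max)
        (tame_shift st_tame i j))) => //.
      case: acc Hacc => [y|] Hacc; last first.
        apply: spec_ret; apply: (running_ext (fun x => extend x el)).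
        by apply: (running_step le_trans Hacc) => /=.
      have [v _ Ey] : exists2 v, eligible v /\ (v.1 \in r1 \/ v.1 = i /\ v.2 \in c1) &
          y = D v.
        by case: Hacc.
      apply: (spec_bind_eq (spec_leM (tD (i, j)) _)) => //; first by rewrite Ey.
      apply: spec_ret; apply: (running_ext (fun x => extend x el)).
      apply: (running_step le_trans Hacc); case: ifP => //=.
      - by move/negbT/(nleW M_total).
      - by move=> H; split=> //; left.
      - by move=> _; split=> //; right.
    * by rewrite size_enum_ord; lia.
    * move=> acc' /running_ext; apply=> x; rewrite mem_rcons inE mem_enum.
      split=> -[Ex]; first by case=> [->|[-> _]]; rewrite ?orbT ?eqxx.
      by case/orP=> [/eqP|]; split=> //; [right|left].
- by rewrite size_enum_ord; lia.
move=> acc Hacc; apply: spec_ret.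
case: acc Hacc => [y [[x [Ex _] ->] Hy]|Hn] /=.
  split; last exact: tD.
  split; first exact: eligible_candidate.
  by move=> _ /candidate_eligible[z Ez ->]; apply: Hy; rewrite mem_enum.
have [i Hi] := ex_lower stars_max T_small.
have [j Hj] : exists j, ~~ left_col T j.
  by apply: (ex_right stars_max); apply: leq_trans T_small _; case/andP: hs.
case: (Hn (i, j)); rewrite mem_enum; split=> //; rewrite /eligible /= thirdE.
rewrite class3_lower //=; move: Hj; rewrite left_stars //.
by case: (cstar st j).
Qed.

Lemma spec_raise d : tame A P (raised A (incr st) T d) -> P d ->
  spec P (raise st third d) (6 * s)
    (eq (PState (raised A (incr st) T d) (rstar st) (cstar st) (nstar st))).
Proof.
clear T_small; move=> t' Pd; have s0 : (0 < s)%N by case/andP: hs.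
apply: (spec_bind_eq (v := raised A (incr st) T d) (c1 := (s * 5).+1)); last exact:
    spec_ret.
  apply: spec_weak.
  - apply: (@spec_foreach M P 'I_s _ (fun r (l : {ffun 'I_s -> M}) => forall i,
      l i = if i \in r then raised A (incr st) T d i else incr st i) _ _ _ 4) => //.
    move=> r1 i r2 l E Hl.
    have Ei : l i = incr st i by rewrite Hl (negPf (enum_prefix E)).
    apply: (spec_bind_eq (spec_read _ _ _)) => //.
    have Er : raised A (incr st) T d i = if third i then incr st i + d else incr st i.
      by rewrite ffunE thirdE.
    case Ci: (third i) Er => Er; last first.
      apply: spec_ret => k; rewrite Hl mem_rcons inE.
      by case: eqP => [->|] //=; rewrite Er; case: ifP.
    have Pl : P (l i) by rewrite Ei; apply: tame_incr st_tame i.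
    apply: (spec_bind_eq (spec_readM Pl)) => //.
    apply: (spec_bind_eq (spec_add Pl Pd)) => //.
    have Px : P (l i + d) by rewrite Ei -Er; apply: tame_incr t' i.
    apply: (spec_weak (spec_writeM _ _ Px)) => // _ <- k.
    by rewrite updE mem_rcons inE; case: eqP => [->|_] /=; [rewrite Er Ei|rewrite Hl].
  - by rewrite size_enum_ord.
  - by move=> l Hl; apply/ffunP => i; rewrite Hl mem_enum.
by lia.
Qed.

End Raise.

(** * Execution of the algorithm *)

Section Execution.
Variable M : porderZmodType.
Hypothesis M_total : total (<=%R : rel M).
Hypothesis M_lerD : forall x y z : M, x <= y -> x + z <= y + z.
Variables (s n : nat).
Hypothesis hs : (1 <= s <= n)%N.
Variable A : 'M[M]_(s, n).
Variable P : pred M.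
Hypothesis below_tame : forall l, below_canons A l -> tame A P l.
Implicit Types (st : pstate M s n).

Definition good_state st : Prop :=
  well_formed st /\ loop_inv A (incr st) (stars st).

(** Each branch of the iteration is one of the transitions: the first search finds
the first class and the second one the third class. *)
Lemma spec_loop_body st : good_state st ->
  spec P (loop_body A st) (200 * (s * n))
    (fun r => match r with
       | inl st' => well_formed st' /\ jacobi_step A (pconfig st) (pconfig st')
       | inr l => jacobi_step A (pconfig st) (Done l)
       end).
Proof.
move=> [[L En] [HT bc]]; have t := below_tame bc.
have [sn1 sn2 sn3 sn4] := dims_bounds hs; have wf : well_formed st by [].
rewrite /loop_body.
apply: (spec_bind_eq (spec_tick _)); first by lia.
case: eqP => Es; first by apply: spec_ret; apply: step_return; rewrite -[RHS]Es En.
have lts : (#|stars st| < s)%N.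
  by rewrite ltn_neqAle (card_transversal HT) andbT -En; apply/eqP.
apply: (spec_bind (spec_col_maxima M_total hs t)); first by lia.
move=> mx Hmx.
apply: (spec_bind (spec_lower_right_max hs L t Hmx)); first by lia.
case=> [[i j] [Hi Hj]|H1].
  have Ei : rstar st i = None by move: Hi; rewrite upper_stars; case: (rstar st i).
  have Ej : cstar st j = None.
    by case/andP: (Hj) => +_; rewrite left_stars //; case: (cstar st j).
  apply: (spec_bind_eq (spec_place_star _ _ _ _)); first by lia.
  apply: (spec_bind_eq (spec_bump_nstar _ _)); first by lia.
  apply: spec_ret; split; first exact: well_formed_add.
  rewrite /pconfig -/(stars _) -/(stars _) -[stars (count_star _)]/(stars (set_star st
      (i, j))).
  by rewrite stars_set_star //; apply: step_add.
apply: (spec_bind (spec_right_maxima hs L t Hmx)); first by lia.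
move=> rm Hrm.
apply: spec_bind.
- apply: (@spec_search M P s _ _ (fun i => isSome (rm i))
    (elem_path (shift A (incr st)) (stars st)) 1 8).
    by move=> k; apply: (spec_bind_eq (spec_read _ _ _)) => //; apply: spec_ret.
  by move=> i k; apply: spec_test_edge.
- by lia.
case=> [seen pred] /= [Hseen Hback].
have class1E k : seen k = class1 (shift A (incr st)) (stars st) k.
  rewrite Hseen; apply: eq_existsb => r; have := Hrm r.
  case: (rm r) => [j Hj|Hr] /=.
    have -> : [exists j, right_max (shift A (incr st)) (stars st) r j] by
        apply/existsP; exists j.
    by case: (boolP (upper_row _ r)) => //= N; have := H1 _ j N; rewrite Hj.
  symmetry; apply/negP => /and3P[_ /existsP[j Hj] _].
  by move: (Hr j); rewrite Hj.
apply: spec_bind.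
- apply: (@spec_first_some M P _ _ _ _ 2 (fun k c => [/\ c = k, rstar st k = None &
    seen k])
    (fun k => ~~ upper_row (stars st) k -> ~~ seen k)).
  move=> k _; apply: (spec_bind_eq (spec_read _ _ _)) => //.
  apply: (spec_bind_eq (spec_read _ _ _)) => //; apply: spec_ret.
  rewrite upper_stars; case: (rstar st k) => [//|] /=.
  by case: ifP => // /negbT.
- by rewrite size_enum_ord; lia.
case=> [k0 [k _ [-> Ek Sk]]|Hno].
  have [i0 [p [[Hroot Hp U Hn Hq] El]]] := Hback _ Sk.
  have := Hrm i0; case Erm: (rm i0) Hroot => [j0|] //= _ Hj0.
  have low : ~~ upper_row (stars st) (last i0 p) by rewrite El upper_stars Ek.
  have U0 : upper_row (stars st) i0.
    by case: (boolP (upper_row _ i0)) => // N; have := H1 _ j0 N; rewrite Hj0.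
    apply: (spec_bind_eq (spec_augment P Erm Hn Hp Hq U El)); first by rewrite
        size_enum_ord; lia.
  apply: spec_ret; split; first exact: (augment_wf wf HT Hj0 Hp U low).
  rewrite /pconfig -/(stars _) -/(stars _) -[stars (count_star _)]/(stars (set_stars _
      _)).
  rewrite (stars_moves j0 Hp U low) [incr _]/= set_stars_incr.
  exact: step_switch.
have H2 : no_lower_class1 (shift A (incr st)) (stars st).
  by move=> i Hi; rewrite -class1E Hno // mem_enum.
apply: (spec_bind (c1 := (s * (s * 13 + 11) + 10)%N)
   (Q1 := fun third : {ffun 'I_s -> bool} => forall i, third i = class3 (shift A (incr
       st)) (stars st) i)).
- apply: spec_bind.
  + apply: (@spec_search M P s _ _ (fun i => ~~ upper_row (stars st) i)
     (fun i k => elem_path (shift A (incr st)) (stars st) k i) 1 8).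
      move=> k; rewrite upper_stars.
      by apply: (spec_bind_eq (spec_read _ _ _)) => //; apply: spec_ret.
    by move=> i k; apply: spec_test_edge.
  + by lia.
  case=> [third pred'] /= [Hthird _]; apply: spec_ret => i; rewrite Hthird.
  by apply: eq_existsb => k; congr (_ && _); exact: (connect_rev (elem_path (shift A
      (incr st)) (stars st)) k i).
- by rewrite size_enum_ord; lia.
move=> third thirdE.
apply: (spec_bind (spec_raise_value M_total hs L t Hmx thirdE HT lts H2)).
  by rewrite size_enum_ord; lia.
move=> d [Hd Pd].
have bc' := raise_below_canons M_total M_lerD HT H1 H2 Hd bc.
apply: (spec_bind_eq (spec_raise hs t thirdE (below_tame bc') Pd)).
  by rewrite size_enum_ord; lia.
apply: spec_ret; split=> //; exact: step_raise.
Qed.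

Lemma spec_init : (1 < s)%N -> spec P (init A) (150 * (s * n))
  (fun st => well_formed st /\ jacobi_step A Start (pconfig st)).
Proof.
move=> s1; have [sn1 sn2 sn3 sn4] := dims_bounds hs.
have t0 := below_tame (below_canons0 A).
apply: (spec_bind (spec_init_increments M_total M_lerD hs t0)); first by lia.
move=> l [Hl Hrow]; have t := below_tame (init_below_canons M_total M_lerD Hl).
apply: (spec_bind (spec_col_maxima M_total hs t)); first by lia.
move=> mx Hmx.
apply: (spec_bind_eq (spec_alloc _ _ _)); first by rewrite card_ord; lia.
apply: (spec_bind_eq (spec_alloc _ _ _)); first by rewrite !card_ord; lia.
apply: (spec_bind (spec_two_maxima M_total hs s1 t Hmx Hrow)).
  by rewrite !card_ord; lia.
case=> [[[i j] [k c]] [/= m1 m2 d1 d2]|//].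
set st0 := PState _ _ _ _.
have wf0 : well_formed st0.
  split; first by move=> a b; rewrite !ffunE.
  rewrite (_ : stars st0 = set0) ?cards0 //.
  by apply/setP => -[a b]; rewrite in_stars ffunE inE.
have wf1 : well_formed (count_star (set_star st0 (i, j))).
  by apply: well_formed_add wf0 _ _; rewrite ffunE.
have N1 : rstar (count_star (set_star st0 (i, j))) k = None.
  by rewrite /= updE ffunE; case: eqP => // E; case: d1.
have N2 : cstar (count_star (set_star st0 (i, j))) c = None.
  by rewrite /= updE ffunE; case: eqP => // E; case: d2.
have wf2 := well_formed_add wf1 N1 N2.
apply: (spec_bind_eq (spec_place_star _ _ _ _)); first by rewrite !card_ord; lia.
apply: (spec_bind_eq (spec_bump_nstar _ _)); first by rewrite !card_ord; lia.
apply: (spec_bind_eq (spec_place_star _ _ _ _)); first by rewrite !card_ord; lia.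
apply: (spec_weak (spec_bump_nstar _ _)); first by rewrite !card_ord; lia.
move=> _ <-; split=> //.
have ET : stars (count_star (set_star (count_star (set_star st0 (i, j))) (k, c))) =
    [set (k, c); (i, j)].
  rewrite -[stars (count_star _)]/(stars (set_star (count_star (set_star st0 (i, j)))
      (k, c))).
  rewrite stars_set_star // -[stars (count_star _)]/(stars (set_star st0 (i, j)))
      stars_set_star ?ffunE //.
  congr (_ |: _); apply/setP => -[a b]; rewrite !inE ffunE /=.
  by rewrite orbF.
apply: (@step_init M s n A l) => //; rewrite -/(stars _) ET.
  split=> [p q|p q|p]; rewrite !inE.
  - by move=> /orP[]/eqP-> /orP[]/eqP-> //= E; case: d1.
  - by move=> /orP[]/eqP-> /orP[]/eqP-> //= E; case: d2.
  - by move=> /orP[]/eqP->.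
by rewrite cards2 xpair_eqE; case: eqP => //= E; case: d1.
Qed.

Lemma loop_exec_spec st : good_state st -> exists t sts l,
  [/\ loop_exec A st t (st :: sts) l,
      jacobi_run A (pconfig st) (rcons (map (@pconfig M s n) sts) (Done l)),
      (size t <= (loop_rank A (incr st) (stars st)).+1 * (200 * (s * n)))%N
    & all (op_ok P) t].
Proof.
have [r] := ubnP (loop_rank A (incr st) (stars st)).
elim: r st => [|r IH] st lt_r good; first by move: lt_r; rewrite ltn0.
have [Hsz Hok Hres] := spec_loop_body good.
case E: (loop_body A st) Hsz Hok Hres => [t [st'|l]] /= Hsz Hok; last first.
  move=> stp; exists t, [::], l; split=> //; first exact: loop_exit.
  by apply: leq_trans Hsz _; rewrite mulSn leq_addr.
case=> wf' stp; have [wf inv] := good.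
have inv' : loop_inv A (incr st') (stars st').
  exact: (step_inv M_total M_lerD hs (c := pconfig st) inv stp).
have lt_rank := step_rank M_lerD inv stp.
have [|t' [sts [l [Hex Hrun Hsz' Hok']]]] := IH st' _ (conj wf' inv').
  exact: leq_trans lt_rank _.
exists (t ++ t'), (st' :: sts), l; split.
- exact: loop_next E Hex.
- by split.
- rewrite size_cat mulSn leq_add //; apply: leq_trans Hsz' _.
  by rewrite leq_mul2r lt_rank orbT.
- by rewrite all_cat Hok.
Qed.

Lemma run_minimal cs l : jacobi_run A Start (rcons cs (Done l)) -> minimal_canon A l.
Proof.
move=> run; have := run_inv M_total M_lerD hs (c := Start) I run.
by rewrite last_rcons.
Qed.

(** By [loop_rank_le] there are at most [6 * s ^ 2] iterations of the main loop, at
[200 * (s * n)] operations each; the rest of the constant covers the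
initialization. *)
Lemma jacobi_exec_spec : exists t sts l,
  [/\ jacobi_exec A t sts l, implements_run A sts l, minimal_canon A l,
      (size t <= 2000 * (s ^ 3 * n))%N & all (op_ok P) t].
Proof.
have [sn1 sn2 sn3 sn4] := dims_bounds hs.
have s3 : (s * n <= s ^ 3 * n)%N by rewrite leq_mul2r expnS leq_pmulr ?expn_gt0 ?orbT
    //; case/andP: hs => ->.
have [s1|/eqP s1] := eqVneq s 1%N.
  have run : jacobi_run A Start [:: Done [ffun=> 0]] by split=> //; apply: step_trivial.
  have [Hsz Hok Hv] : spec P (let! _ := tick in alloc 'I_s (0 : M)) 2 (eq [ffun=> 0]).
    apply: (spec_bind_eq (spec_tick _)) => //.
    by apply: (spec_weak (spec_alloc _ _ _)) => //; rewrite card_ord s1.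
  exists (let! _ := tick in alloc 'I_s (0 : M)).1, [::], [ffun=> 0]; split=> //.
  - exact: exec_trivial.
  - exact: (@run_minimal [::]).
  - apply: leq_trans Hsz _; lia.
have s2 : (1 < s)%N by lia.
have [Hsz Hok Hv] : spec P (let! _ := tick in init A) (150 * (s * n)).+1
    (fun st => well_formed st /\ jacobi_step A Start (pconfig st)).
  apply: (spec_bind_eq (spec_tick _)) => //.
  by apply: (spec_weak (spec_init s2)) => //; rewrite subn1.
case E: (let! _ := tick in init A) Hsz Hok Hv => [t st] /= Hsz Hok [wf stp].
have inv : loop_inv A (incr st) (stars st).
  exact: (step_inv M_total M_lerD hs (c := Start) I stp).
have [t' [sts [l [Hex Hrun Hsz' Hok']]]] := loop_exec_spec (conj wf inv).
have run : implements_run A (st :: sts) l by split.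
exists (t ++ t'), (st :: sts), l; split=> //.
- exact: exec_main E Hex.
- exact: run_minimal run.
- have le_rank : ((loop_rank A (incr st) (stars st)).+1 <= 6 * (s * s))%N.
    by apply: leq_ltn_trans (loop_rank_le A (incr st) (stars st)) _; nia.
  have le2 : ((loop_rank A (incr st) (stars st)).+1 * (200 * (s * n)) <= 1200 * (s ^ 3
      * n))%N.
    apply: leq_trans (_ : 6 * (s * s) * (200 * (s * n)) <= _)%N.
      by rewrite leq_mul2r le_rank orbT.
    by rewrite !expnS expn0 muln1; lia.
  rewrite size_cat; lia.
- by rewrite all_cat Hok.
Qed.


Lemma start_progress : exists c, jacobi_step A Start c.
Proof.
have [s1|/eqP s1] := eqVneq s 1%N; first by exists (Done [ffun=> 0]); apply: step_trivial.
have s2 : (1 < s)%N by move: hs; lia.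
have [_ _ [_ stp]] := spec_init s2.
by exists (pconfig (init A).2).
Qed.

(** Any set of transversal maxima can be stored in the tables of the program, so
that what is known of the program applies to all configurations. *)
Lemma good_state_of_loop l T : loop_inv A l T ->
  exists2 st, good_state st & pconfig st = Loop l T.
Proof.
move=> inv; have [[inj1 inj2 _] _] := inv.
pose st : pstate M s n := PState l [ffun i => [pick j | (i, j) \in T]]
  [ffun j => [pick i | (i, j) \in T]] #|T|.
have rE i j : (rstar st i == Some j) = ((i, j) \in T).
  rewrite ffunE; case: pickP => [j' Hj'|Hn]; last by rewrite Hn.
  apply/eqP/idP => [[<-] //|Hj].
  by have [->] := inj1 _ _ Hj Hj' erefl.
have ET : stars st = T by apply/setP => -[i j]; rewrite in_stars rE.
exists st; last by rewrite /pconfig -/(stars st) ET.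
split; last by rewrite ET.
split; last by rewrite ET.
move=> i j; rewrite rE ffunE; case: pickP => [i' Hi'|Hn]; last by rewrite Hn.
apply/eqP/idP => [[<-] //|Hi].
by have [->] := inj2 _ _ Hi Hi' erefl.
Qed.

Lemma loop_progress l T : loop_inv A l T -> exists c, jacobi_step A (Loop l T) c.
Proof.
case/good_state_of_loop=> st /spec_loop_body[_ _ Hv] <-.
case: (loop_body A st).2 Hv => [st' [_ stp]|l' stp]; first by exists (pconfig st').
by exists (Done l').
Qed.

End Execution.

Lemma tame_predT (M : porderZmodType) (s n : nat) (A : 'M[M]_(s, n)) l : tame A predT l.
Proof. by []. Qed.

(** * Size of the operands *)

(** Subtracting from [l] its least entry gives another canon, so this entry is zero
by minimality.  The starred element of that row is then at most [c] and bounds its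
column in [A + l]. *)
Lemma minimal_canon_le (M : porderZmodType) (M_total : total (<=%R : rel M))
    (M_lerD : forall x y z : M, x <= y -> x + z <= y + z)
    (s n : nat) (A : 'M[M]_(s, n)) (c : M) l :
  (forall i j, 0 <= A i j <= c) -> minimal_canon A l -> forall i, l i <= c.
Proof.
move=> HA [[pos [T HT cT]] le_l] i.
have [i0 Hi0] := ex_max_fin M_total (fun k => - l k) i.
have {}Hi0 k : 0 <= l k - l i0.
  by have := Hi0 k; rewrite -(le_sub0 M_lerD) opprK addrC.
have l0 : l i0 <= 0.
  have can : canon A [ffun k => l k - l i0].
    split=> [k|]; first by rewrite ffunE.
    exists T => //; have [inj1 inj2 Hm] := HT; split=> // p Hp.
    apply/forallP => k; have := forallP (Hm _ Hp) k.
    by rewrite !shiftE !ffunE !addrA (leD2r M_lerD).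
  by have := le_l _ can i0; rewrite ffunE subrr.
have /existsP[j Hj] := full_upper HT cT i0.
have [_ _ /(_ _ Hj) /forallP /(_ i)] := HT; rewrite !shiftE /= => Hm.
have /andP[A0 _] := HA i j; have /andP[_ Ac] := HA i0 j.
apply: (@le_trans _ _ (A i j + l i)).
  by rewrite -{1}(add0r (l i)) (leD2r M_lerD).
apply: le_trans Hm _; apply: le_trans Ac.
by rewrite -{2}(addr0 (A i0 j)) (leD2l M_lerD).
Qed.

Definition bounded_by (N : nat) : pred int := fun x => (`|x| <= N)%N.

Lemma below_canons_bounded (s n : nat) (A : 'M[int]_(s, n)) (C : nat) lambda l :
  (forall i j, 0 <= A i j <= C%:Z) -> minimal_canon A lambda ->
  below_canons A l -> tame A (bounded_by (2 * C)) l.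
Proof.
move=> HA Hmin [pos le_l].
have lC i : 0 <= l i <= C%:Z.
  rewrite pos (le_trans (le_l _ (proj1 Hmin) i)) //.
  by apply: minimal_canon_le Hmin i => //; [exact: le_total|move=> x y z; rewrite lerD2r].
have b1 (x : int) : 0 <= x <= C%:Z -> (`|x| <= 2 * C)%N by lia.
have b2 (x y : int) : 0 <= x <= C%:Z -> 0 <= y <= C%:Z -> (`|(x + y)%R| <= 2 * C)%N.
  by lia.
have b4 (x y z w : int) : 0 <= x <= C%:Z -> 0 <= y <= C%:Z -> 0 <= z <= C%:Z ->
  0 <= w <= C%:Z -> (`|(x + y - (z + w))%R| <= 2 * C)%N by lia.
split=> [i j|i|i j|i k j]; rewrite /bounded_by ?shiftE.
- exact: b1.
- exact: b1.
- exact: b2.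
- exact: b4.
Qed.

Lemma op_bits_le (C : nat) (o : op int) : (2 <= C)%N ->
  op_ok (bounded_by (2 * C)) o -> (op_bits o <= 6 * trunc_log 2 C)%N.
Proof.
move=> C2; have L1 : (0 < trunc_log 2 C)%N by rewrite trunc_log_gt0.
have bits x : bounded_by (2 * C) x -> (bitsize x <= (trunc_log 2 C).+2)%N.
  move=> Hx; rewrite /bitsize ltnS -trunc_log2_double -?muln2 1?mulnC; last lia.
  exact: leq_trunc_log.
case: o => [x y|x y|x y|x|] /=; last lia.
- by case/andP=> /bits + /bits; lia.
- by case/andP=> /bits + /bits; lia.
- by case/andP=> /bits + /bits; lia.
- by move=> /bits; lia.
Qed.

Lemma bit_cost_le (C : nat) (t : seq (op int)) : (2 <= C)%N ->
  all (op_ok (bounded_by (2 * C))) t ->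
  (bit_cost t <= size t * (6 * trunc_log 2 C))%N.
Proof.
move=> C2; rewrite /bit_cost; elim: t => [|o t IH] /=; first by rewrite big_nil.
case/andP=> /(op_bits_le C2) le_o /IH le_t; rewrite big_cons mulSn.
exact: leq_add.
Qed.

(** Passes from binary digits to the natural logarithm; the factor [ln 2] goes into
the final constant. *)
Lemma trunc_log2_le_ln (R : realType) (C : nat) : (2 <= C)%N ->
  (trunc_log 2 C)%:R * ln 2 <= ln C%:R :> R.
Proof.
move=> C2; have C0 : (0 < C)%N by apply: leq_trans C2.
rewrite mulr_natl -lnXn ?ltr0n // ler_ln ?posrE ?exprn_gt0 ?ltr0n //.
by rewrite -natrX ler_nat trunc_logP.
Qed.

Theorem theorem13 :
  (forall (M : porderZmodType)
          (M_total : total (<=%R : rel M))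
          (M_lerD : forall x y z : M, x <= y -> x + z <= y + z)
          (s n : nat) (hs : (1 <= s <= n)%N) (A : 'M[M]_(s, n)),
     terminates A /\
     exists lambda, minimal_canon A lambda /\ always_returns A lambda)
  /\
  (exists a b : nat,
     forall (M : porderZmodType)
            (M_total : total (<=%R : rel M))
            (M_lerD : forall x y z : M, x <= y -> x + z <= y + z)
            (s n : nat) (hs : (1 <= s <= n)%N) (A : 'M[M]_(s, n)),
     exists t sts lambda,
       [/\ jacobi_exec A t sts lambda, implements_run A sts lambda,
           minimal_canon A lambda
         & (elementary_cost t <= a * (s ^ 3 * n) + b)%N])
  /\
  (forall R : realType, exists a b : R,
     forall (s n : nat) (hs : (1 <= s <= n)%N) (A : 'M[int]_(s, n))
            (C : nat) (hC : (2 <= C)%N)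
            (hA : forall i j, 0 <= A i j <= C%:Z),
     exists t sts lambda,
       [/\ jacobi_exec A t sts lambda, implements_run A sts lambda,
           minimal_canon A lambda
         & (bit_cost t)%:R <= a * ((s ^ 3 * n)%:R * ln (C%:R : R)) + b]).
Proof.
split; last split.
- move=> M tot leD s n hs A; split; first exact: terminates_Start.
  have [t [sts [l [_ _ min_l _ _]]]] := @jacobi_exec_spec M tot leD s n hs A predT (fun
      l _ => tame_predT A l).
  exists l; split=> // cs run stuck.
  have := run_inv tot leD hs (c := Start) I run.
  case: (last Start cs) stuck => [|l' T|l'] stuck inv.
  + have [c stp] := start_progress tot leD hs (fun l _ => tame_predT A l).
    by case: (stuck c).
  + have [c stp] := loop_progress tot leD hs (fun l _ => tame_predT A l) inv.
    by case: (stuck c).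
  congr Done; apply/ffunP => i; apply: le_anti.
  have [can le_l] := min_l; have [can' le_l'] := inv.
  by rewrite le_l' // le_l.
- exists 2000%N, 0%N => M tot leD s n hs A.
  have [t [sts [l [ex run min_l sz _]]]] := @jacobi_exec_spec M tot leD s n hs A predT
      (fun l _ => tame_predT A l).
  by exists t, sts, l; split=> //; rewrite addn0.
move=> R; exists (12000%:R / ln 2), 0 => s n hs A C C2 HA.
have leD (x y z : int) : x <= y -> x + z <= y + z by rewrite lerD2r.
have tot := @le_total _ int : total (<=%R : rel int).
have [_ [_ [m [_ _ min_m _ _]]]] := @jacobi_exec_spec int tot leD s n hs A predT (fun l
    _ => tame_predT A l).
have [t [sts [l [ex run min_l sz ok]]]] :=
  @jacobi_exec_spec int tot leD s n hs A _ (fun l => below_canons_bounded HA min_m).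
exists t, sts, l; split=> //; rewrite addr0.
have ln2 : 0 < ln (2%:R : R) by rewrite ln_gt0 // ltr1n.
have cost : (bit_cost t <= 12000 * ((s ^ 3 * n) * trunc_log 2 C))%N.
  apply: leq_trans (bit_cost_le C2 ok) _.
  apply: leq_trans (_ : 2000 * (s ^ 3 * n) * (6 * trunc_log 2 C) <= _)%N.
    by rewrite leq_mul2r sz orbT.
  by rewrite mulnACA.
apply: le_trans (_ : (12000 * (s ^ 3 * n * trunc_log 2 C))%:R <= _).
  by rewrite ler_nat.
rewrite natrM -mulrA ler_wpM2l ?ler0n // natrM mulrCA ler_wpM2l ?ler0n //.
by rewrite mulrC ler_pdivlMr // trunc_log2_le_ln.
Qed.
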